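(* Let $R$ and $S$ be arbitrary rings and let ${}_RC_S$ be a semidualizing $(R,S)$-bimodule. Let $N\in\operatorname{Mod} S$ with $\mathcal{A}_C(S)\text{-}\operatorname{pd}_SN<\infty$ and let $n\ge0$. Then the following statements are equivalent. (1) $\mathcal{A}_C(S)\text{-}\operatorname{pd}_SN\le n$. (2) $\Omega^n(N)\in\mathcal{A}_C(S)$. (3) $\operatorname{Tor}^S_i(C,N)=0$ for all $i\ge n+1$. (4) There exists an exact sequence $0\to H\to A\to N\to0$ in $\operatorname{Mod} S$ with $A\in\mathcal{A}_C(S)$ and $\mathcal{I}_C(S)\text{-}\operatorname{pd}_SH\le n-1$. (5) There exists an exact sequence $0\to N\to H'\to A'\to0$ in $\operatorname{Mod} S$ with $A'\in\mathcal{A}_C(S)$ and $\mathcal{I}_C(S)\text{-}\operatorname{pd}_SH'\le n$. (5$'$) There exists a $\operatorname{Hom}_S(-,\mathcal{I}_C(S))$-exact exact sequence $0\to N\to H'\to A'\to0$ in $\operatorname{Mod} S$ with $A'\in\mathcal{A}_C(S)$ and $\mathcal{I}_C(S)\text{-}\operatorname{pd}_SH'\le n$.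
   Context: All rings are associative with identity. For a ring $T$, $\operatorname{Mod} T$ is the category of left $T$-modules, and $\operatorname{Mod} T^{op}$ is identified with the category of right $T$-modules. All subcategories are full and closed under isomorphisms. Semidualizing: an $(R,S)$-bimodule ${}_RC_S$ is semidualizing if (a1) ${}_RC$ has a projective resolution by finitely generated projective left $R$-modules; (a2) $C_S$ has a projective resolution by finitely generated projective right $S$-modules; (b1) the homothety map $R\to\operatorname{Hom}_{S^{op}}(C,C)$ is an isomorphism; (b2) the homothety map $S\to\operatorname{Hom}_R(C,C)$ is an isomorphism; (c1) $\operatorname{Ext}_R^{i}(C,C)=0$ for all $i\ge1$; (c2) $\operatorname{Ext}_{S^{op}}^{i}(C,C)=0$ for all $i\geq 1$. Auslander class $\mathcal{A}_C(S)$: all $N\in\operatorname{Mod} S$ such that $\operatorname{Tor}^S_i(C,N)=0$ for all $i\ge1$; $\operatorname{Ext}^i_R(C,C\otimes_SN)=0$ for all $i\ge1$; and the map $\mu_N:N\to\operatorname{Hom}_R(C,C\otimes_SN)$, $\mu_N(x)(c)=c\otimes x$, is an isomorphism. $\mathcal{I}_C(S):=\{\operatorname{Hom}_R(C,I)\mid I\text{ injective in }\operatorname{Mod} R\}\subseteq\operatorname{Mod} S$. For a subcategory $\mathscr{X}$ of $\operatorname{Mod} S$ and $N\in\operatorname{Mod} S$, $\mathscr{X}\text{-}\operatorname{pd}_SN$ is the infimum of the integers $n\ge0$ for which there is an exact sequence $0\to X_n\to\cdots\to X_1\to X_0\to N\to0$ in $\operatorname{Mod} S$ with all $X_i\in\mathscr{X}$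 (and $\infty$ if there is none). Convention: the condition $\mathcal{I}_C(S)\text{-}\operatorname{pd}_SH\le-1$ (occurring in (4) when $n=0$) means $H=0$. $\Omega^n(N)$ denotes an $n$-th syzygy of $N$, i.e. the kernel term in an exact sequence $0\to\Omega^n(N)\to P_{n-1}\to\cdots\to P_0\to N\to0$ with all $P_i$ projective ($\Omega^0(N)=N$). A sequence in $\operatorname{Mod} S$ is $\operatorname{Hom}_S(-,\mathcal{I}_C(S))$-exact if it is exact after applying $\operatorname{Hom}_S(-,X)$ for every $X\in\mathcal{I}_C(S)$. *)

(* Defs.v *)
From HB Require Import structures.
From mathcomp Require Import all_boot all_algebra.
From mathcomp Require Import boolp.

Set Implicit Arguments.
Unset Strict Implicit.
Unset Printing Implicit Defensive.

Import GRing.Theory.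
Local Open Scope ring_scope.
Local Open Scope quotient_scope.

(* Rings are [pzRingType]s, so that the zero ring is allowed; a left T-module
   is an [lmodType T] and a right T-module is an [lmodType T^c]. *)

HB.mixin Record isBimodule (R S : pzRingType) C of GRing.Lmodule R C := {
  ract : C -> S -> C;
  ractA : forall c a b, ract (ract c a) b = ract c (a * b);
  ract1 : forall c, ract c 1 = c;
  ractDl : forall a, {morph ract^~ a : c c' / c + c'};
  ractDr : forall c, {morph ract c : a b / a + b};
  ractZ : forall r c a, ract (r *: c) a = r *: ract c a
}.

#[short(type="bimodType")]
HB.structure Definition Bimodule (R S : pzRingType) :=
  {C of isBimodule R S C & GRing.Lmodule R C}.

Definition rmod (R S : pzRingType) (C : bimodType R S) : Type := C.

Section RightModule.
Variables (R S : pzRingType) (C : bimodType R S).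

HB.instance Definition _ := GRing.Zmodule.on (rmod C).

Definition rmod_scale (a : S^c) (c : rmod C) : rmod C := ract (c : C) a.

Fact rmod_scaleA a b c : rmod_scale a (rmod_scale b c) = rmod_scale (a * b) c.
Proof. exact: ractA. Qed.
Fact rmod_scale1 : left_id 1 rmod_scale.
Proof. exact: ract1. Qed.
Fact rmod_scaleDr : right_distributive rmod_scale +%R.
Proof. by move=> a c c'; apply: ractDl. Qed.
Fact rmod_scaleDl c : {morph rmod_scale^~ c : a b / a + b}.
Proof. by move=> a b; apply: ractDr. Qed.

HB.instance Definition _ := GRing.Zmodule_isLmodule.Build S^c (rmod C)
  rmod_scaleA rmod_scale1 rmod_scaleDr rmod_scaleDl.

End RightModule.

Definition Hom (T : pzRingType) (M N : lmodType T) : Type := {linear M -> N}.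

Section HomGroup.
Variables (T : pzRingType) (M N : lmodType T).
Implicit Types f g h : Hom M N.

Lemma HomP f g : f =1 g -> f = g.
Proof.
case: f g => [f [[cf] [df]]] [g [[cg] [dg]]] /= /funext efg.
by case: _ / efg in cg dg *; rewrite (Prop_irrelevance cf cg)
  (Prop_irrelevance df dg).
Qed.

HB.instance Definition _ := gen_eqMixin (Hom M N).
HB.instance Definition _ := gen_choiceMixin (Hom M N).

Definition Hom_zero : Hom M N := \0 : {linear M -> N}.
Definition Hom_opp f : Hom M N :=
  (-%R : {linear N -> N}) \o (f : {linear M -> N}) : {linear M -> N}.
Definition Hom_add f g : Hom M N :=
  (f : {linear M -> N}) \+ (g : {linear M -> N}) : {linear M -> N}.

Fact Hom_addA : associative Hom_add.
Proof. by move=> f g h; apply: HomP => x; apply: addrA. Qed.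
Fact Hom_addC : commutative Hom_add.
Proof. by move=> f g; apply: HomP => x; apply: addrC. Qed.
Fact Hom_add0 : left_id Hom_zero Hom_add.
Proof. by move=> f; apply: HomP => x; apply: add0r. Qed.
Fact Hom_addN : left_inverse Hom_zero Hom_opp Hom_add.
Proof. by move=> f; apply: HomP => x; apply: addNr. Qed.

HB.instance Definition _ := GRing.isZmodule.Build (Hom M N)
  Hom_addA Hom_addC Hom_add0 Hom_addN.

End HomGroup.

Definition precomp (T : pzRingType) (M N X : lmodType T) (f : {linear M -> N})
  (h : Hom N X) : Hom M X := (h : {linear N -> X}) \o f : {linear M -> X}.

(* Hom_R(C, M) as a left S-module: (a h)(c) = h(c a). *)
Definition HomC (R S : pzRingType) (C : bimodType R S) (M : lmodType R) : Type :=
  Hom C M.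

Section HomModule.
Variables (R S : pzRingType) (C : bimodType R S) (M : lmodType R).

HB.instance Definition _ := GRing.Zmodule.on (HomC C M).

Fact ract_linear a : linear (fun c : C => ract c a : C).
Proof. by move=> r c c'; rewrite ractDl ractZ. Qed.

Definition ract_map (a : S) : Hom C C := HB.pack (fun c : C => ract c a : C)
  (GRing.isLinear.Build R C C *:%R (fun c : C => ract c a : C) (ract_linear a)).

Definition HomC_scale (a : S) (h : HomC C M) : HomC C M :=
  precomp (ract_map a) h.

Fact HomC_scaleA a b h : HomC_scale a (HomC_scale b h) = HomC_scale (a * b) h.
Proof. by apply: HomP => c /=; rewrite ractA. Qed.
Fact HomC_scale1 : left_id 1 HomC_scale.
Proof. by move=> h; apply: HomP => c /=; rewrite ract1. Qed.
Fact HomC_scaleDr : right_distributive HomC_scale +%R.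
Proof. by move=> a h h'; apply: HomP. Qed.
Fact HomC_scaleDl h : {morph HomC_scale^~ h : a b / a + b}.
Proof. by move=> a b; apply: HomP => c /=; rewrite ractDr raddfD. Qed.

HB.instance Definition _ := GRing.Zmodule_isLmodule.Build S (HomC C M)
  HomC_scaleA HomC_scale1 HomC_scaleDr HomC_scaleDl.

End HomModule.

(* The tensor product of C and N over S. Its elements are classes of formal
   sums of pairs (c, x); two formal sums are identified when every S-balanced
   map into an abelian group takes the same value on them. No formal negatives
   are needed, as - (c (x) x) = (- c) (x) x. The universal property is
   [tensor_liftE] and [tensor_sumE] below. *)

Record balanced (R S : pzRingType) (C : bimodType R S) (N : lmodType S)
    (A : zmodType) (b : C -> N -> A) : Prop := Balanced {
  balancedDl : forall c c' x, b (c + c') x = b c x + b c' x;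
  balancedDr : forall c x x', b c (x + x') = b c x + b c x';
  balancedM : forall c a x, b (ract c a) x = b c (a *: x)
}.

Section Tensor.
Variables (R S : pzRingType) (C : bimodType R S) (N : lmodType S).
Implicit Types s t : seq (C * N).

Definition tensor_eval (A : zmodType) (b : C -> N -> A) s : A :=
  \sum_(p <- s) b p.1 p.2.

Definition tensor_eq s t : bool :=
  `[< forall (A : zmodType) (b : C -> N -> A),
        balanced b -> tensor_eval b s = tensor_eval b t >].

Fact tensor_eq_refl : reflexive tensor_eq.
Proof. by move=> s; apply/asboolP. Qed.
Fact tensor_eq_sym : symmetric tensor_eq.
Proof. by move=> s t; apply/asboolP/asboolP => h A b bb; rewrite h. Qed.
Fact tensor_eq_trans : transitive tensor_eq.
Proof.
by move=> t s u /asboolP st /asboolP tu; apply/asboolP => A b bb; rewrite st ?tu.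
Qed.

Canonical tensor_equiv :=
  EquivRel tensor_eq tensor_eq_refl tensor_eq_sym tensor_eq_trans.

Definition tensor : Type := {eq_quot tensor_equiv}.

HB.instance Definition _ := Choice.on tensor.

Definition tensor_class s : tensor := \pi_{eq_quot tensor_equiv} s.

Definition pure (c : C) (x : N) : tensor := tensor_class [:: (c, x)].

(* The map out of the tensor product induced by b, for balanced b. *)
Definition tensor_lift (A : zmodType) (b : C -> N -> A) (u : tensor) : A :=
  tensor_eval b (repr (u : {eq_quot tensor_equiv})).

Lemma tensor_lift_class (A : zmodType) (b : C -> N -> A) s :
  balanced b -> tensor_lift b (tensor_class s) = tensor_eval b s.
Proof.
move=> bb; rewrite /tensor_lift.
have /eqmodP/asboolP : repr (\pi_{eq_quot tensor_equiv} s) = s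
  %[mod {eq_quot tensor_equiv}] by rewrite reprK.
exact.
Qed.

Lemma tensorP (u v : tensor) :
  (forall (A : zmodType) (b : C -> N -> A),
     balanced b -> tensor_lift b u = tensor_lift b v) -> u = v.
Proof.
move=> h; rewrite -[u]reprK -[v]reprK; apply/eqmodP/asboolP => A b bb.
exact: h.
Qed.

Definition tensor_zero : tensor := tensor_class [::].
Definition tensor_add (u v : tensor) : tensor :=
  tensor_class (repr (u : {eq_quot tensor_equiv}) ++
                repr (v : {eq_quot tensor_equiv})).
Definition tensor_opp (u : tensor) : tensor :=
  tensor_class [seq (- p.1, p.2) | p <- repr (u : {eq_quot tensor_equiv})].
Definition tensor_scale (r : R) (u : tensor) : tensor :=
  tensor_class [seq (r *: p.1, p.2) | p <- repr (u : {eq_quot tensor_equiv})].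

Section Lift.
Variables (A : zmodType) (b : C -> N -> A).
Hypothesis bb : balanced b.

Lemma tensor_lift0 : tensor_lift b tensor_zero = 0.
Proof. by rewrite tensor_lift_class // /tensor_eval big_nil. Qed.

Lemma tensor_liftD u v :
  tensor_lift b (tensor_add u v) = tensor_lift b u + tensor_lift b v.
Proof. by rewrite tensor_lift_class // /tensor_eval big_cat. Qed.

Lemma tensor_liftN u : tensor_lift b (tensor_opp u) = - tensor_lift b u.
Proof.
rewrite tensor_lift_class // /tensor_eval big_map -sumrN; apply: eq_bigr.
move=> [c x] _ /=; apply: (addIr (b c x)); rewrite addNr -balancedDl // addNr.
by apply: (addIr (b 0 x)); rewrite -balancedDl // !add0r.
Qed.

Lemma balanced_scale r : balanced (fun c x => b (r *: c) x).
Proof.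
split=> [c c' x|c x x'|c a x]; first by rewrite scalerDr balancedDl.
- by rewrite balancedDr.
- by rewrite -ractZ balancedM.
Qed.

Lemma tensor_lift_scale r u :
  tensor_lift b (tensor_scale r u) = tensor_lift (fun c x => b (r *: c) x) u.
Proof. by rewrite tensor_lift_class // /tensor_eval big_map. Qed.

End Lift.

Fact tensor_addA : associative tensor_add.
Proof. by move=> u v w; apply: tensorP => A b bb; rewrite !tensor_liftD // addrA. Qed.
Fact tensor_addC : commutative tensor_add.
Proof. by move=> u v; apply: tensorP => A b bb; rewrite !tensor_liftD // addrC. Qed.
Fact tensor_add0 : left_id tensor_zero tensor_add.
Proof.
by move=> u; apply: tensorP => A b bb; rewrite tensor_liftD // tensor_lift0 // add0r.
Qed.
Fact tensor_addN : left_inverse tensor_zero tensor_opp tensor_add.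
Proof.
move=> u; apply: tensorP => A b bb.
by rewrite tensor_liftD // tensor_liftN // addNr tensor_lift0.
Qed.

HB.instance Definition _ := GRing.isZmodule.Build tensor
  tensor_addA tensor_addC tensor_add0 tensor_addN.

Fact tensor_scaleA r r' u :
  tensor_scale r (tensor_scale r' u) = tensor_scale (r * r') u.
Proof.
apply: tensorP => A b bb; rewrite !tensor_lift_scale //; last exact: balanced_scale.
by apply: eq_bigr => p _; rewrite scalerA.
Qed.
Fact tensor_scale1 : left_id 1 tensor_scale.
Proof.
move=> u; apply: tensorP => A b bb; rewrite tensor_lift_scale //.
by apply: eq_bigr => p _; rewrite scale1r.
Qed.
Fact tensor_scaleDr : right_distributive tensor_scale +%R.
Proof.
move=> r u v; apply: tensorP => A b bb.
rewrite tensor_lift_scale // tensor_liftD ?tensor_liftD ?tensor_lift_scale //.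
exact: balanced_scale.
Qed.
Fact tensor_scaleDl u : {morph tensor_scale^~ u : r r' / r + r'}.
Proof.
move=> r r'; apply: tensorP => A b bb; rewrite tensor_liftD // !tensor_lift_scale //.
by rewrite -big_split; apply: eq_bigr => p _ /=; rewrite scalerDl balancedDl.
Qed.

HB.instance Definition _ := GRing.Zmodule_isLmodule.Build R tensor
  tensor_scaleA tensor_scale1 tensor_scaleDr tensor_scaleDl.

Lemma tensor_liftE (A : zmodType) (b : C -> N -> A) c x :
  balanced b -> tensor_lift b (pure c x) = b c x.
Proof. by move=> bb; rewrite tensor_lift_class // /tensor_eval big_seq1. Qed.

Lemma pure_balanced : balanced pure.
Proof.
split=> [c c' x|c x x'|c a x]; apply: tensorP => A b bb;
  rewrite ?tensor_liftD // !tensor_liftE //; by case: bb.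
Qed.

Lemma tensor_sumE (u : tensor) : exists s, u = \sum_(p <- s) pure p.1 p.2.
Proof.
exists (repr (u : {eq_quot tensor_equiv})).
rewrite -[LHS]reprK -[LHS]/(tensor_class _).
elim: (repr _) => [|[c x] s IH]; first by rewrite big_nil.
rewrite big_cons -IH; apply: tensorP => A b bb.
by rewrite tensor_liftD // !tensor_lift_class // /tensor_eval big_cons big_seq1.
Qed.

Lemma pureZ r c x : r *: pure c x = pure (r *: c) x.
Proof.
apply: tensorP => A b bb; rewrite [LHS]tensor_lift_scale // !tensor_liftE //.
exact: balanced_scale.
Qed.

Fact pure_linear x : linear (pure^~ x).
Proof. by move=> r c c'; rewrite pureZ (balancedDl pure_balanced). Qed.

(* The canonical map N -> Hom_R(C, C (x)_S N), x |-> (c |-> c (x) x). *)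
Definition mu (x : N) : HomC C tensor := HB.pack (pure^~ x)
  (GRing.isLinear.Build R C tensor *:%R (pure^~ x) (pure_linear x)).

End Tensor.

Section TensorMap.
Variables (R S : pzRingType) (C : bimodType R S) (N N' : lmodType S).
Variable f : {linear N -> N'}.

(* C (x)_S f; [tensor_mapE] needs that (c, x) |-> c (x) f x is balanced. *)
Definition tensor_map : tensor C N -> tensor C N' :=
  tensor_lift (fun c x => pure c (f x)).

Lemma tensor_mapE c x : tensor_map (pure c x) = pure c (f x).
Proof.
apply: tensor_liftE; have [Dl Dr M] := pure_balanced C N'.
by split=> [c1 c2 y|c1 y y'|c1 a y]; rewrite ?linearD ?linearZ ?Dl ?Dr ?M.
Qed.

End TensorMap.

Arguments tensor_map {R S} C {N N'} f.

Definition surjective (A B : Type) (f : A -> B) : Prop :=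
  forall y, exists x, f x = y.

Definition exact_at (A B : Type) (D : zmodType) (f : A -> B) (g : B -> D) :=
  forall y, g y = 0 <-> exists x, f x = y.

Definition short_exact (A B D : zmodType) (f : A -> B) (g : B -> D) : Prop :=
  [/\ injective f, exact_at f g & surjective g].

Definition zero_module (V : zmodType) : Prop := forall x : V, x = 0.

Definition isomorphic (T : pzRingType) (M N : lmodType T) : Prop :=
  exists f : {linear M -> N}, bijective f.

Definition projective (T : pzRingType) (P : lmodType T) : Prop :=
  forall (M N : lmodType T) (g : {linear M -> N}) (f : {linear P -> N}),
  surjective g -> exists h : {linear P -> M}, forall x, g (h x) = f x.

Definition injective_module (T : pzRingType) (I : lmodType T) : Prop :=
  forall (M N : lmodType T) (g : {linear M -> N}) (f : {linear M -> I}),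
  injective g -> exists h : {linear N -> I}, forall x, h (g x) = f x.

Definition fin_gen (T : pzRingType) (M : lmodType T) : Prop :=
  exists (k : nat) (e : 'I_k -> M),
  forall x, exists a : 'I_k -> T, x = \sum_(i < k) a i *: e i.

(* An exact sequence ... -> X_2 -> X_1 -> X_0 -> M -> 0; a finite one is
   extended by zero modules. *)
Record resolution (T : pzRingType) (M : lmodType T) := Resolution {
  res_obj :> nat -> lmodType T;
  res_d : forall i, {linear res_obj i.+1 -> res_obj i};
  res_aug : {linear res_obj 0%N -> M};
  res_exact : forall i, exact_at (res_d i.+1) (res_d i);
  res_exact0 : exact_at (res_d 0%N) res_aug;
  res_surj : surjective res_aug
}.

Definition proj_resolution (T : pzRingType) (M : lmodType T)
  (P : resolution M) : Prop := forall i, projective (P i).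

(* 0 -> X_n -> ... -> X_0 -> M -> 0 *)
Definition length_le (T : pzRingType) (M : lmodType T) (P : resolution M)
  (n : nat) : Prop := forall i, (n < i)%N -> zero_module (P i).

(* Vanishing of Ext^i_T(L, M) and Tor^S_i(C, N), i.e. of the i-th cohomology of
   Hom_T(P, M) for P a projective resolution of L, and of the i-th homology of
   C (x)_S P for P a projective resolution of N. As every module has a
   projective resolution and the choice of P does not matter, we ask for it
   for all P. *)
Definition Ext_zero (T : pzRingType) (i : nat) (L M : lmodType T) : Prop :=
  forall P : resolution L, proj_resolution P ->
  match i with
  | 0 => injective (precomp (X := M) (res_d P 0))
  | j.+1 => exact_at (precomp (X := M) (res_d P j)) (precomp (res_d P j.+1))
  end.

Definition Tor_zero (R S : pzRingType) (i : nat) (C : bimodType R S)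
    (N : lmodType S) : Prop :=
  forall P : resolution N, proj_resolution P ->
  match i with
  | 0 => surjective (tensor_map C (res_d P 0))
  | j.+1 => exact_at (tensor_map C (res_d P j.+1)) (tensor_map C (res_d P j))
  end.

(* X-pd M <= m for a class X of modules. For m < 0 this means M = 0. *)
Definition pd_le (T : pzRingType) (X : lmodType T -> Prop) (M : lmodType T)
    (m : int) : Prop :=
  match m with
  | Posz n => exists2 j, (j <= n)%N & exists P : resolution M,
      length_le P j /\ forall i, (i <= j)%N -> X (P i)
  | Negz _ => zero_module M
  end.

Definition pd_finite (T : pzRingType) (X : lmodType T -> Prop)
  (M : lmodType T) : Prop := exists n : nat, pd_le X M n.

(* K is an n-th syzygy of M: there is an exact sequence
   0 -> K -> P_{n-1} -> ... -> P_0 -> M -> 0 with all P_i projective (its term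
   of index n being K up to isomorphism); for n = 0 this means K = M up to
   isomorphism. *)
Definition syzygy (T : pzRingType) (n : nat) (M K : lmodType T) : Prop :=
  exists P : resolution M,
  [/\ length_le P n, forall i, (i < n)%N -> projective (P i)
    & isomorphic K (P n)].

Definition Hom_exact (T : pzRingType) (X : lmodType T -> Prop)
    (M1 M2 M3 : lmodType T) (f : {linear M1 -> M2}) (g : {linear M2 -> M3}) :=
  forall I : lmodType T, X I ->
  short_exact (precomp (X := I) g) (precomp (X := I) f).

Section Semidualizing.
Variables (R S : pzRingType) (C : bimodType R S).

Fact scale_rmod_linear (r : R) :
  linear (fun c : rmod C => r *: (c : C) : rmod C).
Proof. by move=> a c c'; rewrite scalerDr -ractZ. Qed.

Definition homothetyR (r : R) : Hom (rmod C) (rmod C) :=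
  HB.pack (fun c : rmod C => r *: (c : C) : rmod C)
    (GRing.isLinear.Build S^c (rmod C) (rmod C) *:%R
      (fun c : rmod C => r *: (c : C) : rmod C) (scale_rmod_linear r)).

Definition homothetyS (a : S) : Hom C C := ract_map C a.

Definition fg_proj_resolved (T : pzRingType) (M : lmodType T) : Prop :=
  exists P : resolution M, forall i, projective (P i) /\ fin_gen (P i).

Record semidualizing : Prop := Semidualizing {
  semidual_a1 : fg_proj_resolved C;
  semidual_a2 : fg_proj_resolved (rmod C);
  semidual_b1 : bijective homothetyR;
  semidual_b2 : bijective homothetyS;
  semidual_c1 : forall i, (1 <= i)%N -> Ext_zero i C C;
  semidual_c2 : forall i, (1 <= i)%N -> Ext_zero i (rmod C) (rmod C)
}.

Record auslander (N : lmodType S) : Prop := Auslander {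
  auslander_tor : forall i, (1 <= i)%N -> Tor_zero i C N;
  auslander_ext : forall i, (1 <= i)%N -> Ext_zero i C (tensor C N);
  auslander_mu : bijective (@mu R S C N)
}.

(* The class I_C(S), closed under isomorphisms. *)
Definition C_injective (N : lmodType S) : Prop :=
  exists2 I : lmodType R, injective_module I & isomorphic N (HomC C I).

End Semidualizing.

(* Main.v *)
(**
  Tor(C, -) is computed from a resolution of C_S by finitely generated free
  right modules, so that its long exact sequence is a diagram chase between
  finite powers of modules; the same resolution shows that, for I injective,
  C (x) Hom_R(C, I) = I with vanishing higher Tor, whence I_C(S) lies in A_C(S).
  Every A in A_C(S) embeds in some Hom_R(C, E) (take E an injective module
  containing C (x) A) with cokernel again in A_C(S): this is what turns a
  finite A_C(S)-resolution into the approximations of (4) and (5), by a pushout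
  at each step. Conversely, the kernel of an epimorphism onto a module of
  A_C(S) has no larger A_C(S)-dimension than the source, which bounds the
  dimension in (5) and, through the pullback with an epimorphism from a projective, places
  the syzygies in A_C(S). Finally, a module of dimension at most m + 1 whose Tor
  vanishes from degree m + 1 on has dimension at most m, because a monomorphism
  between modules of A_C(S) that stays injective under C (x) - has its cokernel
  in A_C(S).
*)
From HB Require Import structures.
From mathcomp Require Import all_boot all_order all_algebra.
From mathcomp Require Import boolp classical_sets functions.
Require Import Defs.

Set Implicit Arguments.
Unset Strict Implicit.
Unset Printing Implicit Defensive.

Import GRing.Theory.
Local Open Scope ring_scope.

(** * Submodules and quotients *)

(** [Tor_zero] and [Ext_zero] only speak of vanishing, over all projective resolutions of the first
    argument of Ext and the second of Tor, so neither derived functors nor connecting maps are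
    constructed. Of the long exact sequences only their vanishing consequences are kept, and
    resolutions are compared (balance of Tor, independence of Ext) by dimension shifting. Resolving
    [C] on the right by finite free modules turns the complex for Tor into finite powers of [N];
    powers preserve exactness, so short exact sequences of modules give short exact sequences of
    complexes without a horseshoe lemma. The same matrices compute Hom from the right module [C] to
    itself, and for [I] injective Tor(C, Hom_R(C, I)) becomes the [I]-dual of that Ext. Projective
    modules may be infinitely generated; a dual basis for finitely many elements at a time reduces
    them to [S]. Statement (5') needs no more than (5): by adjunction Hom_S(-, Hom_R(C, E)) is
    Hom_R(C (x) -, E), and Tor_1(C, A') = 0. *)

Definition mklin (T : pzRingType) (M N : lmodType T) (f : M -> N)
    (lf : linear f) : {linear M -> N} :=
  HB.pack f (GRing.isLinear.Build T M N *:%R f lf).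

Definition submodule (T : pzRingType) (V : lmodType T) (P : V -> Prop) :=
  P 0 /\ forall a x y, P x -> P y -> P (a *: x + y).

Section SubmoduleTheory.
Variables (T : pzRingType) (V : lmodType T) (P : V -> Prop).
Hypothesis subP : submodule P.

Lemma submoduleD x y : P x -> P y -> P (x + y).
Proof. by move=> px py; rewrite -[x]scale1r; apply: subP.2. Qed.

Lemma submoduleZ a x : P x -> P (a *: x).
Proof. by move=> px; rewrite -[_ *: _]addr0; apply: subP.2 => //; apply: subP.1. Qed.

Lemma submoduleN x : P x -> P (- x).
Proof. by rewrite -scaleN1r; apply: submoduleZ. Qed.

End SubmoduleTheory.

Section Submodule.
Variables (T : pzRingType) (V : lmodType T) (P : V -> Prop).
Variable subP : submodule P.

Record submod := Submod { submod_val : V; submodP : P submod_val }.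

Lemma submod_inj : injective submod_val.
Proof. by move=> [x px] [y py] /= exy; subst y; rewrite (Prop_irrelevance px py). Qed.

HB.instance Definition _ := gen_eqMixin submod.
HB.instance Definition _ := gen_choiceMixin submod.

Let zero := Submod subP.1.
Let opp x := Submod (submoduleN subP (submodP x)).
Let add x y := Submod (submoduleD subP (submodP x) (submodP y)).
Let scale a x := Submod (submoduleZ subP a (submodP x)).

Let addA : associative add.
Proof. by move=> x y z; apply: submod_inj; apply: addrA. Qed.
Let addC : commutative add.
Proof. by move=> x y; apply: submod_inj; apply: addrC. Qed.
Let add0 : left_id zero add.
Proof. by move=> x; apply: submod_inj; apply: add0r. Qed.
Let addN : left_inverse zero opp add.
Proof. by move=> x; apply: submod_inj; apply: addNr. Qed.

Let zmod := HB.pack_for zmodType submod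
  (GRing.isZmodule.Build submod addA addC add0 addN).

Let scaleA a b (x : zmod) : scale a (scale b x) = scale (a * b) x :> zmod.
Proof. by apply: submod_inj; apply: scalerA. Qed.
Let scale1 : @left_id _ zmod 1 scale.
Proof. by move=> x; apply: submod_inj; apply: scale1r. Qed.
Let scaleDr : @right_distributive _ zmod scale +%R.
Proof. by move=> a x y; apply: submod_inj; apply: scalerDr. Qed.
Let scaleDl (x : zmod) : {morph (scale^~ x : T -> zmod) : a b / a + b}.
Proof. by move=> a b; apply: submod_inj; apply: scalerDl. Qed.

(** The operations on [submod] depend on the closure proof [subP], so the structure is packed
    locally and only its existence leaves the section. *)
Lemma submodule_ex : exists (K : lmodType T) (i : {linear K -> V}),
  injective i /\ forall x, P x <-> exists k, i k = x.
Proof.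
pose K := HB.pack_for (lmodType T) submod zmod
  (GRing.Zmodule_isLmodule.Build T zmod scaleA scale1 scaleDr scaleDl).
have lf : linear (submod_val : K -> V) by [].
exists K, (mklin lf); split; first exact: submod_inj.
move=> x; split=> [px|[k <-]]; first by exists (Submod px).
exact: submodP.
Qed.

End Submodule.

Section Quotient.
Local Open Scope quotient_scope.
Variables (T : pzRingType) (V : lmodType T) (P : V -> Prop).
Variable subP : submodule P.

Let eqv x y := `[< P (x - y) >].
Let eqv_refl : reflexive eqv.
Proof. by move=> x; apply/asboolP; rewrite subrr; apply: subP.1. Qed.
Let eqv_sym : symmetric eqv.
Proof.
by move=> x y; apply/asboolP/asboolP=> /(submoduleN subP); rewrite opprB.
Qed.
Let eqv_trans : transitive eqv.
Proof.
move=> y x z /asboolP xy /asboolP yz; apply/asboolP.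
by rewrite -(subrKA y); apply: submoduleD.
Qed.
Let equiv := EquivRel eqv eqv_refl eqv_sym eqv_trans.
Definition quot : Type := {eq_quot equiv}.
HB.instance Definition _ := Choice.on quot.

Let cl (x : V) : quot := \pi_{eq_quot equiv} x.
Let rp (q : quot) : V := repr (q : {eq_quot equiv}).
Let clK q : cl (rp q) = q. Proof. exact: reprK. Qed.
Let clP x y : cl x = cl y <-> P (x - y).
Proof. by split=> [/eqmodP/asboolP|h] //; apply/eqmodP/asboolP. Qed.
Let rpK x : P (rp (cl x) - x). Proof. by apply/clP; rewrite clK. Qed.

Let zero := cl 0.
Let opp x := cl (- rp x).
Let add x y := cl (rp x + rp y).
Let scale a x := cl (a *: rp x).
Let clN x : opp (cl x) = cl (- x).
Proof. by apply/clP; rewrite -opprD; apply: submoduleN. Qed.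
Let clD x y : add (cl x) (cl y) = cl (x + y).
Proof. by apply/clP; rewrite opprD addrACA; apply: submoduleD. Qed.
Let clZ a x : scale a (cl x) = cl (a *: x).
Proof. by apply/clP; rewrite -scalerBr; apply: submoduleZ. Qed.

Let addA : associative add.
Proof. by move=> x y z; rewrite -[x]clK -[y]clK -[z]clK !clD addrA. Qed.
Let addC : commutative add.
Proof. by move=> x y; rewrite -[x]clK -[y]clK !clD addrC. Qed.
Let add0 : left_id zero add.
Proof. by move=> x; rewrite -[x]clK !clD add0r. Qed.
Let addN : left_inverse zero opp add.
Proof. by move=> x; rewrite -[x]clK clN clD addNr. Qed.

Let zmod := HB.pack_for zmodType quot
  (GRing.isZmodule.Build quot addA addC add0 addN).

Let scaleA a b (x : zmod) : scale a (scale b x) = scale (a * b) x :> zmod.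
Proof. by rewrite -[x]clK !clZ scalerA. Qed.
Let scale1 : @left_id _ zmod 1 scale.
Proof. by move=> x; rewrite -[x]clK clZ scale1r. Qed.
Let scaleDr : @right_distributive _ zmod scale +%R.
Proof.
by move=> a x y; rewrite -[x]clK -[y]clK -[_ + _]/(add _ _) clD !clZ scalerDr -clD.
Qed.
Let scaleDl (x : zmod) : {morph (scale^~ x : T -> zmod) : a b / a + b}.
Proof. by move=> a b; rewrite -[x]clK !clZ scalerDl -clD. Qed.

Lemma quotient_ex : exists (Q : lmodType T) (p : {linear V -> Q}),
  surjective p /\ forall x, p x = 0 <-> P x.
Proof.
pose Q := HB.pack_for (lmodType T) quot zmod
  (GRing.Zmodule_isLmodule.Build T zmod scaleA scale1 scaleDr scaleDl).
have lf : linear (cl : V -> Q) by move=> a x y; rewrite -clD -clZ.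
exists Q, (mklin lf); split=> [q|x]; first by exists (rp q); apply: clK.
by rewrite -[X in P X]subr0; apply: clP.
Qed.

End Quotient.

Section Factor.
Variables (T : pzRingType) (M N V : lmodType T).

Lemma lift_inj (i : {linear N -> V}) (f : {linear M -> V}) :
  injective i -> (forall x, exists y, i y = f x) ->
  exists g : {linear M -> N}, forall x, i (g x) = f x.
Proof.
move=> ii /choice [g gE].
have lg : linear g by move=> a x y; apply: ii; rewrite linearP !gE linearP.
by exists (mklin lg).
Qed.

Lemma factor_surj (p : {linear V -> N}) (f : {linear V -> M}) :
  surjective p -> (forall x, p x = 0 -> f x = 0) ->
  exists g : {linear N -> M}, forall x, g (p x) = f x.
Proof.
move=> /choice [s sE] pf.
have fE x y : p x = p y -> f x = f y.
  by move=> e; apply/subr0_eq; rewrite -linearB; apply: pf; rewrite linearB e subrr.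
have lg : linear (f \o s).
  by move=> a x y /=; rewrite -linearP; apply: fE; rewrite linearP !sE.
by exists (mklin lg) => x; apply: fE; apply: sE.
Qed.

End Factor.

(** * Short exact sequences *)

Section ShortExact.
Variables (T : pzRingType).
Implicit Types A B E H K L M N Q W X Y Z : lmodType T.

Lemma exact_comp0 (A B : Type) (D : zmodType) (f : A -> B) (g : B -> D) x :
  exact_at f g -> g (f x) = 0.
Proof. by move=> fg; apply/fg; exists x. Qed.

Lemma linear_inj M N (f : {linear M -> N}) :
  (forall x, f x = 0 -> x = 0) -> injective f.
Proof. by move=> h x y e; apply/subr0_eq/h; rewrite linearB e subrr. Qed.

Lemma linear_inj0 M N (f : {linear M -> N}) x :
  injective f -> f x = 0 -> x = 0.
Proof. by move=> fI e; apply: fI; rewrite e linear0. Qed.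

Lemma zero_module_ex : exists Z : lmodType T, zero_module Z.
Proof.
have sub0 : @submodule T T^o (fun x => x = 0).
  by split=> // a x y -> ->; rewrite scaler0 addr0.
have [Z [i [iI iE]]] := submodule_ex sub0.
by exists Z => z; apply: (linear_inj0 iI); apply/iE; exists z.
Qed.

Lemma ker_ex M N (f : {linear M -> N}) :
  exists K (i : {linear K -> M}), injective i /\ exact_at i f.
Proof.
apply: submodule_ex; split=> [|a x y fx fy]; first exact: linear0.
by rewrite linearP fx fy scaler0 addr0.
Qed.

Lemma coker_ex M N (f : {linear M -> N}) :
  exists Q (p : {linear N -> Q}), surjective p /\ exact_at f p.
Proof.
apply: quotient_ex; split=> [|a _ _ [x <-] [y <-]].
  by exists 0; rewrite linear0.
by exists (a *: x + y); rewrite linearP.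
Qed.

Lemma short_exact_ker M N (p : {linear M -> N}) :
  surjective p -> exists K (i : {linear K -> M}), short_exact i p.
Proof. by move=> ps; have [K [i []]] := ker_ex p; exists K, i; split. Qed.

Lemma short_exact_coker M N (i : {linear M -> N}) :
  injective i -> exists Q (p : {linear N -> Q}), short_exact i p.
Proof. by move=> iI; have [Q [p []]] := coker_ex i; exists Q, p; split. Qed.

Lemma short_exact_pullback K A N L B (i : {linear K -> A}) (p : {linear A -> N})
    (j : {linear L -> B}) (q : {linear B -> N}) :
  short_exact i p -> short_exact j q ->
  exists W (i' : {linear K -> W}) (p' : {linear W -> B})
    (j' : {linear L -> W}) (q' : {linear W -> A}),
    short_exact i' p' /\ short_exact j' q'.
Proof.
move=> [iI ip ps] [jI jq qs].
pose Q (x : A * B) := p x.1 = q x.2.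
have sQ : submodule Q.
  split=> [|a x y]; first by rewrite /Q !linear0.
  by rewrite /Q /= => ex ey; rewrite !linearP ex ey.
have [W [w [wI wE]]] := submodule_ex sQ.
have wQ x : p (w x).1 = q (w x).2 by apply/wE; exists x.
have li : linear (fun k => (i k, 0) : A * B).
  by move=> a x y; rewrite linearP -[RHS]/(_, _) /= scaler0 addr0.
have lj : linear (fun k => (0, j k) : A * B).
  by move=> a x y; rewrite linearP -[RHS]/(_, _) /= scaler0 addr0.
have lp : linear (fun x => (w x).2) by move=> a x y; rewrite linearP.
have lq : linear (fun x => (w x).1) by move=> a x y; rewrite linearP.
have [|i' i'E] := lift_inj (f := mklin li) wI.
  by move=> x; apply/wE; rewrite /Q /= linear0 (exact_comp0 _ ip).
have [|j' j'E] := lift_inj (f := mklin lj) wI.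
  by move=> x; apply/wE; rewrite /Q /= linear0 (exact_comp0 _ jq).
exists W, i', (mklin lp), j', (mklin lq); split; split.
- by move=> x y e; have := i'E x; rewrite e i'E => -[/iI].
- move=> x; rewrite /=; split=> [x2|[k <-]]; last by rewrite i'E.
  have /ip [k ek] : p (w x).1 = 0 by rewrite wQ x2 linear0.
  by exists k; apply: wI; rewrite i'E /= ek -x2; case: (w x).
- move=> b; have [a ea] := ps (q b); have /wE [x ex] : Q (a, b) by [].
  by exists x; rewrite /= ex.
- by move=> x y e; have := j'E x; rewrite e j'E => -[/jI].
- move=> x; rewrite /=; split=> [x1|[k <-]]; last by rewrite j'E.
  have /jq [k ek] : q (w x).2 = 0 by rewrite -wQ x1 linear0.
  by exists k; apply: wI; rewrite j'E /= ek -x1; case: (w x).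
- move=> a; have [b eb] := qs (p a); have /wE [x ex] : Q (a, b) by [].
  by exists x; rewrite /= ex.
Qed.

Lemma short_exact_pushout K A N H X (i : {linear K -> A}) (p : {linear A -> N})
    (j : {linear K -> H}) (q : {linear H -> X}) :
  short_exact i p -> short_exact j q ->
  exists Z (i' : {linear H -> Z}) (p' : {linear Z -> N})
    (j' : {linear A -> Z}) (q' : {linear Z -> X}),
    short_exact i' p' /\ short_exact j' q'.
Proof.
move=> [iI ip ps] [jI jq qs].
(* The quotient is by the pairs [(i k, j k)], without the usual minus sign: the two maps from [K] to
   [Z] then agree up to sign ([zij]), which does not affect exactness. *)
have ld : linear (fun k => (i k, j k) : A * H) by move=> a x y; rewrite !linearP.
have [Z [z [zs dz]]] := coker_ex (mklin ld).
have li : linear (fun h => z (0, h)).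
  by move=> a x y; rewrite -linearP; congr (z _); rewrite -[RHS]/(_, _) /= scaler0 addr0.
have lj : linear (fun h => z (h, 0)).
  by move=> a x y; rewrite -linearP; congr (z _); rewrite -[RHS]/(_, _) /= scaler0 addr0.
have lp : linear (fun x : A * H => p x.1) by move=> a x y; rewrite linearP.
have lq : linear (fun x : A * H => q x.2) by move=> a x y; rewrite linearP.
have [|p' p'E] := factor_surj (f := mklin lp) zs.
  by move=> x /dz [k <-] /=; apply: (exact_comp0 _ ip).
have [|q' q'E] := factor_surj (f := mklin lq) zs.
  by move=> x /dz [k <-] /=; apply: (exact_comp0 _ jq).
have zd k : z (i k, j k) = 0 by apply/dz; exists k.
have zD a h : z (a, h) = z (a, 0) + z (0, h).
  by rewrite -linearD; congr (z _); rewrite -[RHS]/(_, _) /= addr0 add0r.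
have zij k : z (i k, 0) = - z (0, j k) by apply/eqP; rewrite -addr_eq0 -zD zd.
exists Z, (mklin li), p', (mklin lj), q'; split; split.
- by apply: linear_inj => h /= /dz [k [/(linear_inj0 iI) -> <-]]; rewrite linear0.
- move=> x; split=> [|[h <-]]; last by rewrite /= p'E /= linear0.
  have [[a h] <-] := zs x; rewrite p'E /= => /ip [k <-].
  by exists (h - j k); rewrite /= [RHS]zD zij [RHS]addrC -linearB;
    congr (z _); rewrite -[RHS]/(_, _) /= subrr.
- by move=> y; have [a <-] := ps y; exists (z (a, 0)); rewrite p'E.
- by apply: linear_inj => h /= /dz [k [<- /(linear_inj0 jI) ->]]; rewrite linear0.
- move=> x; split=> [|[h <-]]; last by rewrite /= q'E /= linear0.
  have [[a h] <-] := zs x; rewrite q'E /= => /jq [k <-].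
  exists (a - i k); rewrite /= [RHS]zD -[z (0, _)]opprK -zij -linearB.
  by congr (z _); rewrite -[RHS]/(_, _) /= subrr.
- by move=> y; have [a <-] := qs y; exists (z (0, a)); rewrite q'E.
Qed.

(** [K'] is the preimage of [K] under [a], obtained as the kernel of [p \o a]; it contains the
    kernel of [a], so [L] is unchanged. *)
Lemma short_exact_preimage L A E K X (l : {linear L -> A}) (a : {linear A -> E})
    (i : {linear K -> E}) (p : {linear E -> X}) :
  short_exact l a -> short_exact i p ->
  exists K' (i' : {linear K' -> A}) (p' : {linear A -> X})
    (l' : {linear L -> K'}) (a' : {linear K' -> K}),
    short_exact i' p' /\ short_exact l' a'.
Proof.
move=> [lI la as_] [iI ip ps]; pose p' := p \o a : {linear A -> X}.
have [K' [k [kI kp]]] := ker_ex p'.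
have pk x : p (a (k x)) = 0 by apply: (exact_comp0 _ kp).
have [|a' a'E] := lift_inj (f := a \o k) iI; first by move=> x; apply/ip/pk.
have [|l' l'E] := lift_inj (f := l) kI.
  by move=> x; apply/kp; rewrite /= (exact_comp0 _ la) linear0.
exists K', k, p', l', a'; split; split=> //.
- by move=> x; have [e <-] := ps x; have [b <-] := as_ e; exists b.
- by move=> x y e; apply: lI; rewrite -!l'E e.
- move=> x; split=> [e|[y <-]]; last first.
    by apply: iI; rewrite a'E linear0 /= l'E (exact_comp0 _ la).
  have /la [y ey] : a (k x) = 0 by rewrite -[LHS]a'E e linear0.
  by exists y; apply: kI; rewrite l'E.
- move=> y; have [b eb] := as_ (i y).
  have /kp [x ex] : p' b = 0 by rewrite /= eb (exact_comp0 _ ip).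
  by exists x; apply: iI; rewrite a'E /= ex.
Qed.

(** [Q] is [Y] modulo the image of [H]; the second sequence is the third isomorphism theorem. *)
Lemma short_exact_quotient H A N Y X (h : {linear H -> A}) (a : {linear A -> N})
    (i : {linear A -> Y}) (p : {linear Y -> X}) :
  short_exact h a -> short_exact i p ->
  exists Q (h' : {linear H -> Y}) (a' : {linear Y -> Q})
    (i' : {linear N -> Q}) (p' : {linear Q -> X}),
    short_exact h' a' /\ short_exact i' p'.
Proof.
move=> [hI ha as_] [iI ip ps]; pose h' := i \o h : {linear H -> Y}.
have [Q [q [qs hq]]] := coker_ex h'.
have qh x : q (i (h x)) = 0 by apply: (exact_comp0 _ hq).
have [|p' p'E] := factor_surj (f := p) qs.
  by move=> _ /hq [x <-]; apply: (exact_comp0 _ ip).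
have [|i' i'E] := factor_surj (f := q \o i) as_.
  by move=> _ /ha [x <-]; apply: qh.
exists Q, h', q, i', p'; split; split=> //.
- by move=> x y /iI/hI.
- apply: linear_inj => x; have [y <-] := as_ x; rewrite i'E => /hq [z /iI <-].
  exact: (exact_comp0 _ ha).
- move=> x; split=> [|[y <-]]; last first.
    by have [z <-] := as_ y; rewrite i'E p'E (exact_comp0 _ ip).
  by have [y <-] := qs x; rewrite p'E => /ip [z <-]; exists (a z); rewrite i'E.
- by move=> x; have [y <-] := ps x; exists (q y); rewrite p'E.
Qed.

Lemma short_exact_zerol H A N (f : {linear H -> A}) (g : {linear A -> N}) :
  short_exact f g -> zero_module H -> injective g.
Proof.
by move=> [_ fg _] H0; apply: linear_inj => x /fg [y <-]; rewrite (H0 y) linear0.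
Qed.

Lemma short_exact_id Z A (f : {linear Z -> A}) :
  zero_module Z -> short_exact f (idfun : {linear A -> A}).
Proof.
move=> Z0; split; first by move=> x y _; rewrite (Z0 x) (Z0 y).
- move=> x; split=> [/= ->|[y <-]]; first by exists 0; rewrite linear0.
  by rewrite /= (Z0 y) linear0.
- by move=> x; exists x.
Qed.

Lemma isomorphic_refl M : isomorphic M M.
Proof. exists (idfun : {linear M -> M}); exact: (Bijective (g := id)). Qed.

Lemma inj_surj_bij (A B : Type) (f : A -> B) :
  injective f -> surjective f -> bijective f.
Proof. by move=> fI /choice [g gE]; exists g => // x; apply: fI. Qed.

Lemma bij_surj (A B : Type) (f : A -> B) : bijective f -> surjective f.
Proof. by move=> [g _ gK] x; exists (g x). Qed.

Lemma isomorphic_sym M N : isomorphic M N -> isomorphic N M.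
Proof.
move=> [f [g fK gK]].
have lg : linear g by move=> a x y; apply: (can_inj fK); rewrite linearP !gK.
by exists (mklin lg); exists f; [exact: gK | exact: fK].
Qed.

Lemma isomorphic_trans M N X : isomorphic M N -> isomorphic N X -> isomorphic M X.
Proof.
move=> [f fb] [g gb]; exists (g \o f : {linear M -> X}); exact: bij_comp.
Qed.

Lemma short_exact_middle_iso H A N (f : {linear H -> A}) (g : {linear A -> N}) :
  short_exact f g -> zero_module H -> isomorphic A N.
Proof.
move=> fg H0; exists g; apply: inj_surj_bij; first exact: short_exact_zerol fg H0.
by case: fg.
Qed.

End ShortExact.

(** * Resolutions and dimension *)

Section Resolutions.
Variables (T : pzRingType).
Implicit Types A B E H K L M N Q W X Y Z : lmodType T.

Definition res_tail M (P : resolution M) K (a : {linear P 1%N -> K})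
    (sa : surjective a) (ea : exact_at (res_d P 1) a) : resolution K :=
  @Resolution T K (fun i => P i.+1) (fun i => res_d P i.+1) a
    (fun i => @res_exact T M P i.+1) ea sa.

(** [K] is the first syzygy and [a] the corestriction of [res_d P 0] to it. Together with [res_tail]
    this peels off one term, which is how inductions along a resolution proceed. *)
Lemma res_tail_ex M (P : resolution M) :
  exists K (i : {linear K -> P 0%N}) (a : {linear P 1%N -> K}),
    [/\ short_exact i (res_aug P), surjective a, exact_at (res_d P 1) a
      & forall x, i (a x) = res_d P 0 x].
Proof.
have [K [i iP]] := short_exact_ker (@res_surj _ _ P); have [iI ip _] := iP.
have [|a aE] := lift_inj (f := res_d P 0) iI.
  by move=> x; apply/ip; apply: (exact_comp0 _ (@res_exact0 _ _ P)).
have a0 x : a x = 0 <-> res_d P 0 x = 0.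
  by rewrite -aE; split=> [->|/(linear_inj0 iI) //]; rewrite linear0.
exists K, i, a; split=> // [k|x].
  have /(@res_exact0 _ _ P) [x ex] : res_aug P (i k) = 0 by apply: (exact_comp0 _ ip).
  by exists x; apply: iI; rewrite aE.
by rewrite a0; apply: res_exact.
Qed.

Section Cons.
Variables (K P M : lmodType T) (f : {linear K -> P}) (g : {linear P -> M}).
Variables (fg : short_exact f g) (R : resolution K).

Let obj i : lmodType T := if i is j.+1 then R j else P.
Let d i : {linear obj i.+1 -> obj i} :=
  match i with 0 => f \o res_aug R : {linear _ -> _} | j.+1 => res_d R j end.

Let d_exact i : exact_at (d i.+1) (d i).
Proof.
case: i => [|i]; last exact: res_exact.
move=> y; rewrite -(@res_exact0 _ _ R) /=; case: fg => fI _ _.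
by split=> [/(linear_inj0 fI)|->] //; rewrite linear0.
Qed.

Let d_exact0 : exact_at (d 0) g.
Proof.
case: fg => _ gf _ y; rewrite gf; split=> -[x <-]; last by exists (res_aug R x).
by have [z <-] := @res_surj _ _ R x; exists z.
Qed.

Let g_surj : surjective g. Proof. by case: fg. Qed.

Definition res_cons : resolution M := Resolution d_exact d_exact0 g_surj.

End Cons.

Section Zero.
Variables (Z : lmodType T) (Z0 : zero_module Z).
Let z : {linear Z -> Z} := idfun.
Let ez (i : nat) : exact_at z z.
Proof. by move=> x; split=> _; [exists x|apply: Z0]. Qed.
Let sz : surjective z. Proof. by move=> x; exists x. Qed.
(** On a zero module the identity is also the zero map, so it can serve as every differential. *)
Definition res_zero : resolution Z :=
  @Resolution T Z (fun=> Z) (fun=> z) z ez (ez 0) sz.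
End Zero.

(** [Q] is the invariant that lets the step be repeated, [X] the property of the terms produced.
    Iteration needs the step as data, hence the subtype [st] and the extraction by [cid]. *)
Lemma resolution_ex (Q X : lmodType T -> Prop) :
  (forall M, Q M -> exists K (P : lmodType T) (i : {linear K -> P}) (p : {linear P -> M}),
     [/\ short_exact i p, X P & Q K]) ->
  forall M, Q M -> exists P : resolution M, forall i, X (P i).
Proof.
move=> step M QM.
pose st := {N : lmodType T | Q N}.
have F (m : st) : {k : st & {P : lmodType T & {i : {linear sval k -> P} &
    {p : {linear P -> sval m} | short_exact i p /\ X P}}}}.
  case: m => N QN; have /cid [K /cid [P /cid [i /cid [p [ip XP QK]]]]] := step N QN.
  by exists (exist _ K QK), P, i, p.
pose m := fix m n : st := if n is n'.+1 then projT1 (F (m n')) else exist _ M QM.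
pose P n : lmodType T := projT1 (projT2 (F (m n))).
pose i n : {linear sval (m n.+1) -> P n} := projT1 (projT2 (projT2 (F (m n)))).
pose p n : {linear P n -> sval (m n)} := sval (projT2 (projT2 (projT2 (F (m n))))).
have ip n : short_exact (i n) (p n) by case: (svalP (projT2 (projT2 (projT2 (F (m n)))))).
have XP n : X (P n) by case: (svalP (projT2 (projT2 (projT2 (F (m n)))))).
pose d n : {linear P n.+1 -> P n} := i n \o p n.+1.
have de0 n : exact_at (d n) (p n).
  have [_ pi _] := ip n; have [_ _ ps] := ip n.+1.
  move=> y; rewrite pi; split=> -[x <-]; last by exists (p n.+1 x).
  by have [z <-] := ps x; exists z.
have de n : exact_at (d n.+1) (d n).
  have [iI _ _] := ip n; move=> y; rewrite -de0 /=.
  by split=> [/(linear_inj0 iI)|->] //; rewrite linear0.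
have ps : surjective (p 0%N) by case: (ip 0%N).
by exists (Resolution de (de0 0%N) ps).
Qed.

(** A finite resolution cut into short exact sequences, the form suited to induction. It takes
    exactly [n] steps; padding by zero modules ([pdi_succ]) turns this into at most [n]. *)
Fixpoint pdi (X : lmodType T -> Prop) n M : Prop :=
  if n is n'.+1 then exists K A (f : {linear K -> A}) (g : {linear A -> M}),
    [/\ short_exact f g, X A & pdi X n' K]
  else X M.

Fixpoint syz n M K : Prop :=
  if n is n'.+1 then exists L (P : lmodType T) (f : {linear L -> P}) (g : {linear P -> M}),
    [/\ short_exact f g, projective P & syz n' L K]
  else isomorphic K M.

Lemma length0_iso M (P : resolution M) : length_le P 0 -> isomorphic (P 0%N) M.
Proof.
move=> P0; have [K [i [a [ip sa _ _]]]] := res_tail_ex P.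
apply: (short_exact_middle_iso ip) => k; have [x <-] := sa k.
by rewrite (P0 1%N isT x) linear0.
Qed.

Definition res_self Z (Z0 : zero_module Z) M : resolution M :=
  res_cons (short_exact_id (\0 : {linear Z -> M}) Z0) (res_zero Z0).

Section Class.
Variable X : lmodType T -> Prop.
Hypothesis Xiso : forall M N, isomorphic M N -> X M -> X N.
Hypothesis X0 : forall Z, zero_module Z -> X Z.

Lemma pdi_succ n M : pdi X n M -> pdi X n.+1 M.
Proof.
elim: n M => [|n IH] M /=.
  move=> XM; have [Z Z0] := zero_module_ex T.
  exists Z, M, (\0 : {linear Z -> M}), (idfun : {linear M -> M}); split=> //.
    exact: short_exact_id.
  exact: X0.
by move=> [K [A [f [g [fg XA /IH dK]]]]]; exists K, A, f, g.
Qed.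

Lemma pdi_leq m n M : (m <= n)%N -> pdi X m M -> pdi X n M.
Proof. by move=> /subnK <-; elim: (n - m)%N => // k IH /IH; apply: pdi_succ. Qed.

(** A resolution of length 0 only gives [P 0] isomorphic to [M], hence [Xiso]; lengthening from [j]
    to [n] inserts zero modules, hence [X0]. *)
Lemma pd_leP n M : pd_le X M n%:Z <-> pdi X n M.
Proof.
split=> [[j jn [P [Pj PX]]]|].
  apply: (pdi_leq jn); elim: j M P Pj PX {jn} => [|j IH] M P Pj PX.
    exact: Xiso (length0_iso Pj) (PX 0%N _).
  have [K [i [a [ip sa ea _]]]] := res_tail_ex P.
  exists K, (P 0%N), i, (res_aug P); split=> //; first exact: PX.
  by apply: (IH K (res_tail sa ea)) => k hk; [apply: Pj | apply: PX].
move=> dM; exists n => //; elim: n M dM => [|n IH] M.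
  have [Z Z0] := zero_module_ex T.
  by move=> XM; exists (res_self Z0 M); split; case.
move=> [K [A [f [g [fg XA /IH [P [Pn PX]]]]]]].
exists (res_cons fg P); split; case=> [|i] // hi; [exact: Pn | exact: PX].
Qed.

End Class.

Lemma syzygyP n M K : syzygy n M K <-> syz n M K.
Proof.
split.
  elim: n M => [|n IH] M [P [Pn PP KP]].
    exact: isomorphic_trans KP (length0_iso Pn).
  have [L [i [a [ip sa ea _]]]] := res_tail_ex P.
  exists L, (P 0%N), i, (res_aug P); split=> //; first exact: PP.
  apply: IH; exists (res_tail sa ea); split=> // k hk; [exact: Pn | exact: PP].
elim: n M => [|n IH] M.
  have [Z Z0] := zero_module_ex T.
  by move=> KM; exists (res_self Z0 M); split=> //; case.
move=> [L [P [f [g [fg PP /IH [Q [Qn QP KQ]]]]]]].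
exists (res_cons fg Q); split=> //; case=> [|i] // hi; [exact: Qn | exact: QP].
Qed.

End Resolutions.

(** * Injective modules *)

Section Divisible.
Import Order.TTheory Num.Theory.
Local Open Scope classical_set_scope.

Definition subgroup (V : zmodType) (G : set V) :=
  G 0 /\ forall x y, G x -> G y -> G (x - y).

Lemma subgroupN (V : zmodType) (G : set V) x : subgroup G -> G x -> G (- x).
Proof. by move=> [G0 GB] Gx; rewrite -sub0r; apply: GB. Qed.

Lemma subgroupD (V : zmodType) (G : set V) x y :
  subgroup G -> G x -> G y -> G (x + y).
Proof. by move=> sG Gx Gy; rewrite -[y]opprK; apply: sG.2 => //; apply: subgroupN. Qed.

Lemma subgroup_mulz (V : zmodType) (G : set V) x k :
  subgroup G -> G x -> G (x *~ k).
Proof.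
move=> sG Gx; have Gn n : G (x *+ n).
  by elim: n => [|n IH]; rewrite ?mulr0n ?mulrS; [apply: sG.1 | apply: subgroupD].
by case: k => n; rewrite ?NegzE ?mulrNz -pmulrn //; apply: subgroupN.
Qed.

Definition divisible (D : zmodType) :=
  forall n (y : D), (0 < n)%N -> exists z, z *+ n = y.

(** The graph of a homomorphism from a subgroup of [M] to [D]. Extension of partial maps becomes
    inclusion of sets, so Zorn's lemma applies to plain unions. *)
Definition graph (M D : zmodType) (G : set (M * D)) :=
  subgroup G /\ forall y, G (0, y) -> y = 0.

Variables (M D : zmodType).
Hypothesis divD : divisible D.

Lemma pair_mulz (x : M) (y : D) k : (x, y) *~ k = (x *~ k, y *~ k).
Proof.
have pn n : (x, y) *+ n = (x *+ n, y *+ n).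
  by elim: n => [|n IH]; rewrite ?mulr0n // !mulrS IH.
by case: k => n; rewrite ?NegzE ?mulrNz -!pmulrn pn.
Qed.

Lemma graph_eq (G : set (M * D)) x y y' : graph G -> G (x, y) -> G (x, y') -> y = y'.
Proof.
move=> [[_ GB] G0] h h'; apply/subr0_eq/G0; rewrite -(subrr x); exact: (GB _ _ h h').
Qed.

Lemma graph_step (G : set (M * D)) x : graph G ->
  exists2 G' : set (M * D), graph G' & G `<=` G' /\ exists y, G' (x, y).
Proof.
move=> gG; have [sG G0] := gG.
(* The value to be given to [x]. The [k] with [x *~ k] in the domain of [G] form an ideal of the
   integers: if it has a least positive element [n], [z] is an [n]-th part of the value at [x *+ n];
   otherwise [0] will do. *)
have [z zP] : exists z, forall k w, G (x *~ k, w) -> w = z *~ k.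
  have [[n0 [n0_gt0 [w0 Gw0]]]|no] :=
      pselect (exists n, (0 < n)%N /\ exists w, G (x *+ n, w)).
    have exn : exists n, (0 < n)%N && `[< exists w, G (x *+ n, w) >].
      by exists n0; rewrite n0_gt0; apply/asboolP; exists w0.
    case: (ex_minnP exn) => n /andP [n_gt0 /asboolP [w Gw]] nmin.
    have [z ez] := divD w n_gt0; exists z => k v Gv.
    have nk : (k %% n)%Z = 0.
      apply/eqP; apply: contraT => r0; have nz : n%:Z != 0 by case: (n) n_gt0.
      have rn : (k %% n)%Z < n%:Z by rewrite ltz_pmod.
      have r_ge0 := modz_ge0 k nz.
      case er : (k %% n)%Z r0 rn r_ge0 => [r|//] r0 rn _.
      have rpos : (0 < r)%N by rewrite lt0n.
      have : (n <= r)%N.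
        apply: nmin; rewrite rpos; apply/asboolP; exists (v - w *~ (k %/ n)%Z).
        have -> : x *+ r = x *~ k - x *+ n *~ (k %/ n)%Z.
          by rewrite {1}(divz_eq k n) er mulrzDr !pmulrn -mulrzA mulrC addrAC subrr add0r.
        have := sG.2 _ _ Gv (subgroup_mulz (k %/ n)%Z sG Gw).
        by rewrite pair_mulz.
      by rewrite leqNgt; move: rn; rewrite ltz_nat => ->.
    apply: (graph_eq gG Gv); have := subgroup_mulz (k %/ n)%Z sG Gw.
    by rewrite pair_mulz -ez !pmulrn -!mulrzA mulrC -[X in X * _]/(k %/ n)%Z
      -[((k %/ n)%Z * n)](addr0) -nk -divz_eq.
  exists 0 => k w Gw; rewrite mul0rz.
  have [k0|k0] := eqVneq k 0; first by apply: G0; rewrite -[X in (X, _)](mulr0z x) -k0.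
  exfalso; apply: no; exists (absz k); rewrite absz_gt0 k0; split=> //.
  case: k Gw {k0} => n Gw; first by exists w; rewrite /= pmulrn.
  exists (- w); have := subgroupN sG Gw.
  by rewrite -[- (_, _)]/(- _, - _) NegzE mulrNz opprK pmulrn.
exists [set p | exists q k, G q /\ p = q + (x, z) *~ k].
  split; first split.
  - by exists 0, 0; rewrite mulr0z addr0; split=> //; apply: sG.1.
  - move=> _ _ [q [k [Gq ->]]] [q' [k' [Gq' ->]]].
    exists (q - q'), (k - k'); split; first exact: sG.2.
    by rewrite mulrzBr opprD addrACA.
  - move=> y [[q1 q2] [k [Gq]]]; rewrite pair_mulz => -[e1 ->].
    have e : x *~ (- k) = q1.
      by apply/eqP; rewrite mulrNz eq_sym -addr_eq0 -e1.
    by move: Gq; rewrite -e => /zP ->; rewrite mulrNz addNr.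
split; first by move=> p Gp; exists p, 0; rewrite mulr0z addr0.
by exists z, 0, 1; split; [exact: sG.1 | rewrite mulr1z add0r].
Qed.

Lemma divisible_extend (G : set (M * D)) : graph G ->
  exists h : M -> D, (forall x y, h (x - y) = h x - h y) /\
    forall x y, G (x, y) -> h x = y.
Proof.
(* Zorn's lemma also asks for the union of the empty chain, which need not contain [G]; adjoining
   [G] inside [Q] makes that case [G] itself. *)
move=> gG; pose Q (A : set (M * D)) := graph (A `|` G).
have [F FQ Ftot|A [QA Amax]] := @Zorn_bigcup _ Q.
  have common p q : (\bigcup_(X in F) X `|` G) p -> (\bigcup_(X in F) X `|` G) q ->
      exists B, [/\ graph B, B p, B q & B `<=` \bigcup_(X in F) X `|` G].
    have sF X : F X -> X `|` G `<=` \bigcup_(X in F) X `|` G.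
      by move=> FX; apply: setSU => x Xx; exists X.
    move=> [[X FX Xp]|Gp] [[Y FY Yq]|Gq].
    - have [XY|YX] := Ftot _ _ FX FY.
        by exists (Y `|` G); split; [exact: FQ|left; exact: XY|left|exact: sF].
      by exists (X `|` G); split; [exact: FQ|left|left; exact: YX|exact: sF].
    - by exists (X `|` G); split; [exact: FQ|left|right|exact: sF].
    - by exists (Y `|` G); split; [exact: FQ|right|left|exact: sF].
    - by exists G; split=> // x Gx; right.
  split; first split.
  - by right; apply: gG.1.1.
  - move=> p q hp hq; have [B [gB Bp Bq sB]] := common _ _ hp hq.
    by apply: sB; apply: gB.1.2.
  - by move=> y h; have [B [gB Bp _ _]] := common _ _ h h; apply: gB.2 Bp.
have tot x : exists y, (A `|` G) (x, y).
  have [G' gG' [AG' [y Gy]]] := graph_step x QA.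
  exists y; apply: contrapT => ny; apply: (Amax G').
    split; first by move=> p Ap; apply: AG'; left.
    by move=> sG'; apply: ny; left; apply: sG'.
  by rewrite /Q setUidl // => p Gp; apply: AG'; right.
have /choice [h hP] := tot; exists h; split=> [x y|x y Gxy].
  apply: (graph_eq QA (hP _)); exact: (QA.1.2 _ _ (hP x) (hP y)).
by apply: (graph_eq QA (hP x)); right.
Qed.

End Divisible.

Section Separating.
Import Order.TTheory Num.Theory.

(* The witness is Q/Z. *)
Lemma divisible_separating_ex : exists2 D : zmodType, divisible D &
  forall (M : zmodType) (x : M), x != 0 -> exists h : M -> D,
    (forall y z, h (y - z) = h y - h z) /\ h x != 0.
Proof.
(* Abelian groups are taken as modules over [int] so that [quotient_ex] applies. *)
pose Z (q : zmodule rat) := exists k : int, q = (k%:~R : rat).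
have subZ : submodule Z.
  split=> [|a _ _ [k ->] [l ->]]; first by exists 0.
  by exists (k * a + l); rewrite -[LHS]/((k%:~R : rat) *~ a + l%:~R) -mulrzr -intrM -intrD.
have [D [p [ps pZ]]] := quotient_ex subZ.
have divD : divisible D.
  move=> n y n_gt0; have [q <-] := ps y; exists (p ((q : rat) / n%:R : rat)).
  rewrite -raddfMn; congr (p _); rewrite -[LHS]/((q : rat) / n%:R *+ n).
  by rewrite -mulr_natr divfK // pnatr_eq0 -lt0n.
have half (d : nat) : (1 < d)%N -> p (d%:R^-1 : rat) != 0.
  move=> d1; apply/eqP => /pZ [k ek].
  have d0 : 0 < d%:R :> rat by rewrite ltr0n ltnW.
  have k0 : 0 < k by rewrite -(ltr0z rat) -ek invr_gt0.
  have : (k%:~R : rat) < 1 by rewrite -ek invf_lt1 ?ltr1n.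
  by rewrite -[1]/(1%:~R) ltr_int ltNge -gtz0_ge1 k0.
exists D => // M x x0.
(* [d] is the additive order of [x], or [2] if that is infinite. Sending [x] to the class of [1/d]
   is then well defined on the multiples of [x], and nonzero because [1 < d]. *)
have [d [d1 dP]] : exists d, (1 < d)%N /\ forall k : int, x *~ k = 0 ->
    p (d%:R^-1 : rat) *~ k = 0.
  have [exn|no] := pselect (exists n, (0 < n)%N && (x *+ n == 0)).
    case: (ex_minnP exn) => n /andP [n_gt0 /eqP xn] nmin.
    exists n; split.
      case: n n_gt0 xn {nmin} => [|[|n]] // _; rewrite mulr1n => x00.
      by rewrite x00 eqxx in x0.
    move=> k xk.
    have nz : n%:Z != 0 by case: (n) n_gt0.
    have nk : (k %% n)%Z = 0.
      apply/eqP; apply: contraT => r0.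
      have rn : (k %% n)%Z < n%:Z by rewrite ltz_pmod.
      have r_ge0 := modz_ge0 k nz.
      case er : (k %% n)%Z r0 rn r_ge0 => [r|//] r0 rn _.
      have rpos : (0 < r)%N by rewrite lt0n.
      have : (n <= r)%N.
        apply: nmin; rewrite rpos /=.
        move: xk; rewrite {1}(divz_eq k n) er mulrzDr mulrC mulrzA -!pmulrn xn.
        by rewrite mul0rz add0r => ->.
      by rewrite leqNgt; move: rn; rewrite ltz_nat => ->.
    rewrite -raddfMz; apply/pZ; exists (k %/ n)%Z.
    rewrite -[LHS]/((n%:R^-1 : rat) *~ k) {1}(divz_eq k n) nk addr0 mulrC mulrzA.
    suff -> : (n%:R^-1 : rat) *~ n = 1 by [].
    by rewrite -mulrzr -pmulrn mulVf // pnatr_eq0 -lt0n.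
  exists 2; split=> // k xk; have [->|k0] := eqVneq k 0; first by rewrite mulr0z.
  exfalso; apply: no; exists (absz k); rewrite absz_gt0 k0 /=.
  case: k xk {k0} => n xn; first by rewrite /= pmulrn xn.
  by move: xn; rewrite NegzE mulrNz => /eqP; rewrite oppr_eq0.
set y := p _ in dP.
pose G : set (M * D) := fun u => exists k : int, u = (x *~ k, y *~ k).
have [|h [hB hG]] := divisible_extend divD (G := G).
  split; last by move=> v [k [] /esym /dP e ->].
  split; first by exists 0; rewrite !mulr0z.
  by move=> _ _ [k ->] [l ->]; exists (k - l); rewrite !mulrzBr.
exists h; split=> //; rewrite (hG x y); first exact: half.
by exists 1; rewrite !mulr1z.
Qed.

End Separating.

Lemma morphB_D (U V : zmodType) (f : U -> V) :
  {morph f : x y / x - y} -> {morph f : x y / x + y}.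
Proof.
move=> fB x y; have f0 : f 0 = 0 by rewrite -(subrr 0) fB subrr.
by rewrite -{1}[y]opprK fB -[- y]sub0r fB f0 sub0r opprK.
Qed.

Section CharacterModule.
Variables (T : pzRingType) (X : Type) (D : zmodType).

(** The elements of Hom_Z(T, D)^X, where scalars act by right multiplication on the argument from
    [T]: a product of coinduced left modules. *)
Record charmod := Charmod {
  charmod_fun :> X -> T -> D;
  charmodB : forall x, {morph charmod_fun x : a b / a - b} }.

Lemma charmod_inj (f g : charmod) : (forall x a, f x a = g x a) -> f = g.
Proof.
case: f g => [f fB] [g gB] /= e.
have {}e : f = g by apply/funext => x; apply/funext.
by case: _ / e in gB *; rewrite (Prop_irrelevance fB gB).
Qed.

HB.instance Definition _ := gen_eqMixin charmod.
HB.instance Definition _ := gen_choiceMixin charmod.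

Let zero_subproof (x : X) : {morph (fun _ : T => (0 : D)) : a b / a - b}.
Proof. by move=> a b; rewrite subr0. Qed.
Let zero := Charmod zero_subproof.
Let opp_subproof (f : charmod) x : {morph (fun a => - f x a) : a b / a - b}.
Proof. by move=> a b; rewrite charmodB opprB opprK addrC. Qed.
Let opp f := Charmod (opp_subproof f).
Let add_subproof (f g : charmod) x : {morph (fun a => f x a + g x a) : a b / a - b}.
Proof. by move=> a b; rewrite !charmodB opprD addrACA. Qed.
Let add f g := Charmod (add_subproof f g).
Let scale_subproof c (f : charmod) x : {morph (fun a => f x (a * c)) : a b / a - b}.
Proof. by move=> a b; rewrite mulrBl charmodB. Qed.
Let scale c f := Charmod (scale_subproof c f).

Fact charmod_addA : associative add.
Proof. by move=> f g h; apply: charmod_inj => x a; apply: addrA. Qed.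
Fact charmod_addC : commutative add.
Proof. by move=> f g; apply: charmod_inj => x a; apply: addrC. Qed.
Fact charmod_add0 : left_id zero add.
Proof. by move=> f; apply: charmod_inj => x a; apply: add0r. Qed.
Fact charmod_addN : left_inverse zero opp add.
Proof. by move=> f; apply: charmod_inj => x a; apply: addNr. Qed.

HB.instance Definition _ := GRing.isZmodule.Build charmod
  charmod_addA charmod_addC charmod_add0 charmod_addN.

Fact charmod_scaleA a b f : scale a (scale b f) = scale (a * b) f.
Proof. by apply: charmod_inj => x c; rewrite /= mulrA. Qed.
Fact charmod_scale1 : left_id 1 scale.
Proof. by move=> f; apply: charmod_inj => x a; rewrite /= mulr1. Qed.
Fact charmod_scaleDr : right_distributive scale +%R.
Proof. by move=> a f g; apply: charmod_inj. Qed.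
Fact charmod_scaleDl f : {morph scale^~ f : a b / a + b}.
Proof.
by move=> a b; apply: charmod_inj => x c; rewrite /= mulrDr morphB_D //; apply: charmodB.
Qed.

HB.instance Definition _ := GRing.Zmodule_isLmodule.Build T charmod
  charmod_scaleA charmod_scale1 charmod_scaleDr charmod_scaleDl.

End CharacterModule.

Section EnoughInjectives.
Variables (T : pzRingType).

(** Evaluation at [1] identifies [T]-linear maps into [charmod] with [X]-indexed families of
    additive maps into [D], and each of these extends because [D] is divisible. *)
Lemma charmod_injective (X : Type) (D : zmodType) :
  divisible D -> injective_module (charmod T X D).
Proof.
move=> divD M N g f gI.
have ext (x : X) : exists h : N -> D, {morph h : a b / a - b} /\
    forall m, h (g m) = f m x 1.
  pose G (u : N * D) := exists m, u = (g m, f m x 1).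
  have [|h [hB hG]] := divisible_extend divD (G := G).
    split; last by move=> y [m [/esym/(linear_inj0 gI) -> ->]]; rewrite linear0.
    split; first by exists 0; rewrite !linear0.
    by move=> _ _ [m ->] [m' ->]; exists (m - m'); rewrite !linearB.
  by exists h; split=> // m; apply: hG; exists m.
have /choice [h hP] := ext.
have hB n x : {morph (fun a : T => h x (a *: n)) : a b / a - b}.
  by move=> a b; rewrite scalerBl (hP x).1.
have lh : linear (fun n => Charmod (hB n) : charmod T X D).
  move=> a m n; apply: charmod_inj => x b /=.
  by rewrite scalerDr scalerA (morphB_D (hP x).1).
exists (mklin lh) => m; apply: charmod_inj => x a /=.
by rewrite -linearZ (hP x).2 linearZ /= mul1r.
Qed.

(** One coordinate is taken for every character of [M]; the map is injective because characters
    separate points. *)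
Lemma enough_injectives (M : lmodType T) :
  exists (I : lmodType T) (f : {linear M -> I}), injective_module I /\ injective f.
Proof.
have [D divD sepD] := divisible_separating_ex.
pose X := {h : M -> D | {morph h : a b / a - b}}.
have FB m (x : X) : {morph (fun a : T => sval x (a *: m)) : a b / a - b}.
  by move=> a b; rewrite scalerBl (svalP x).
have lF : linear (fun m => Charmod (FB m) : charmod T X D).
  move=> a m n; apply: charmod_inj => x b /=.
  by rewrite scalerDr scalerA (morphB_D (svalP x)).
exists (charmod T X D), (mklin lF); split; first exact: charmod_injective.
apply: linear_inj => m /(congr1 (fun c : charmod T X D => c : X -> T -> D)) e.
apply/eqP; apply: contraT => /sepD [h [hB /eqP []]].
by have := congr1 (fun F => F (exist _ h hB) 1) e; rewrite /= scale1r.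
Qed.

End EnoughInjectives.

(** * Free and projective modules *)

Section FreeModules.
Variable T : pzRingType.
Implicit Types A B E F H K L M N P Q W Y Z : lmodType T.

Lemma big_uniq_subset (I : eqType) N (f : I -> N) (s t : seq I) :
  uniq s -> uniq t -> {subset s <= t} -> (forall i, i \notin s -> f i = 0) ->
  \sum_(i <- t) f i = \sum_(i <- s) f i.
Proof.
move=> us ut st f0; rewrite (bigID (mem s)) /= [X in _ + X]big1 ?addr0; last first.
  by move=> i /f0.
rewrite -big_filter; apply: perm_big; apply: uniq_perm; rewrite ?filter_uniq //.
by move=> i; rewrite mem_filter; case: (boolP (i \in s)) => // /st ->.
Qed.

(** The module of finitely supported functions, seen through its coordinates [phi]. The last clause
    allows any list containing the support, so that two elements can be expanded over a common
    list. *)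
Lemma free_module_ex (X : eqType) : exists F (e : X -> F)
  (phi : X -> {linear F -> T^o}),
  [/\ forall x y, phi x (e y) = (x == y)%:R,
      forall u, exists s, uniq s /\ forall x, x \notin s -> phi x u = 0
    & forall u s, uniq s -> (forall x, x \notin s -> phi x u = 0) ->
        u = \sum_(x <- s) (phi x u : T) *: e x].
Proof.
pose fs (f : X -> T^o) := exists s : seq X, forall x, x \notin s -> f x = 0.
have sfs : submodule fs.
  split=> [|a f g [s hs] [t ht]]; first by exists [::].
  exists (s ++ t) => x; rewrite mem_cat negb_or => /andP [xs xt].
  by rewrite -[LHS]/(a *: f x + g x) hs // ht // scaler0 addr0.
have [F [w [wI wE]]] := submodule_ex sfs.
have /choice [e eP] (y : X) : exists u, w u = fun x => (x == y)%:R.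
  by apply/wE; exists [:: y] => x; rewrite inE => /negPf ->.
have lphi x : linear (fun u => w u x : T^o) by move=> a u v; rewrite linearP.
exists F, e, (fun x => mklin (lphi x)); split=> [x y|u|u s us hs] /=.
- by rewrite eP.
- have /wE [s hs] : exists k, w k = w u by exists u.
  exists (undup s); rewrite undup_uniq; split=> // x.
  by rewrite mem_undup; apply: hs.
- apply: wI; apply/funext => x; rewrite linear_sum /= fct_sumE.
  under eq_bigr => y _ do rewrite linearZ /= eP.
  under eq_bigr => y _ do rewrite -[_ x]/(w u y * (x == y)%:R).
  have [xs|xs] := boolP (x \in s); last first.
    rewrite big1_seq => [|y /andP [_ ys]]; first exact: hs.
    by case: eqP => [exy|_]; rewrite ?mulr0 // -exy (negPf xs) in ys *.
  rewrite (bigD1_seq x) //= eqxx mulr1 big1 ?addr0 // => y.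
  by rewrite eq_sym => /negPf ->; rewrite mulr0.
Qed.

Lemma free_module_lift (X : eqType) F (e : X -> F) (phi : X -> {linear F -> T^o}) N
    (g : X -> N) :
  (forall x y, phi x (e y) = (x == y)%:R) ->
  (forall u, exists s, uniq s /\ forall x, x \notin s -> phi x u = 0) ->
  exists h : {linear F -> N}, forall x, h (e x) = g x.
Proof.
move=> phie /choice [s sP].
have E u t : uniq t -> (forall x, x \notin t -> phi x u = 0) ->
    \sum_(x <- s u) (phi x u : T) *: g x = \sum_(x <- t) (phi x u : T) *: g x.
  move=> ut ht; set r := undup (s u ++ t).
  rewrite -(@big_uniq_subset _ _ _ (s u) r) ?undup_uniq ?(sP u).1 //.
  - rewrite (@big_uniq_subset _ _ _ t r) ?undup_uniq //.
      by move=> x xt; rewrite mem_undup mem_cat xt orbT.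
    by move=> x /ht ->; rewrite scale0r.
  - by move=> x xt; rewrite mem_undup mem_cat xt.
  - by move=> x /(sP u).2 ->; rewrite scale0r.
have lh : linear (fun u => \sum_(x <- s u) (phi x u : T) *: g x).
  move=> a u v; set t := undup (s u ++ s v).
  have hu x : x \notin t -> phi x u = 0.
    by rewrite mem_undup mem_cat negb_or => /andP [xs _]; apply: (sP u).2.
  have hv x : x \notin t -> phi x v = 0.
    by rewrite mem_undup mem_cat negb_or => /andP [_ xs]; apply: (sP v).2.
  rewrite !(E _ t) ?undup_uniq // => [|x xt]; last first.
    by rewrite linearP hu // hv // scaler0 addr0.
  rewrite scaler_sumr -big_split; apply: eq_bigr => x _.
  by rewrite linearP scalerDl scalerA.
exists (mklin lh) => x /=; rewrite (E _ [:: x]) // => [|y].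
  by rewrite big_seq1 phie eqxx scale1r.
by rewrite inE phie => /negPf ->.
Qed.

Lemma enough_projectives M : exists P (p : {linear P -> M}),
  projective P /\ surjective p.
Proof.
have [F [e [phi [phie fs uE]]]] := free_module_ex M.
have [p pE] := free_module_lift id phie fs.
exists F, p; split; last by move=> m; exists (e m).
move=> A B g f /choice [r rE].
have [h hE] := free_module_lift (fun x => r (f (e x))) phie fs.
exists h => u; have [s [us hs]] := fs u; rewrite (uE u s us hs) !linear_sum.
by apply: eq_bigr => x _; rewrite !linearZ hE rE.
Qed.

Lemma projective_section P M (p : {linear M -> P}) :
  projective P -> surjective p -> exists s : {linear P -> M}, cancel s p.
Proof. by move=> PP ps; have [s sE] := PP _ _ p idfun ps; exists s => x; apply: sE. Qed.

(** The dual basis lemma for finitely many elements: only finitely many coordinates of a free cover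
    are involved, so a finite [b] suffices although [P] is an arbitrary projective. *)
Lemma projective_dual_basis P (xs : seq P) : projective P ->
  exists b : seq ({linear P -> T^o} * P),
    forall x, x \in xs -> x = \sum_(q <- b) (q.1 x : T) *: q.2.
Proof.
move=> PP; have [F [e [phi [phie fs uE]]]] := free_module_ex P.
have [p pE] := free_module_lift id phie fs.
have [|s sK] := projective_section PP (p := p); first by move=> m; exists (e m).
have /choice [t tP] (x : P) := fs (s x).
set r := undup (flatten (map t xs)).
exists [seq (phi y \o s : {linear P -> T^o}, p (e y)) | y <- r] => x xxs.
rewrite big_map /= -[LHS]sK [X in p X](uE _ r) ?undup_uniq //.
  by rewrite linear_sum; apply: eq_bigr => y _; rewrite linearZ.
move=> y yr; apply: (tP x).2; apply: contra yr => yt.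
by rewrite mem_undup; apply/flattenP; exists (t x) => //; apply: map_f.
Qed.

Lemma zero_projective Z : zero_module Z -> projective Z.
Proof.
move=> Z0 A B g f _; exists (\0 : {linear Z -> A}) => x.
by rewrite (Z0 x) !linear0.
Qed.

Lemma prod_projective P Q : projective P -> projective Q ->
  projective ((P * Q)%type : lmodType T).
Proof.
move=> PP QQ A B g f gs.
have lP : linear (fun x : P => f (x, 0)).
  by move=> a x y; rewrite -linearP; congr (f _); rewrite -[RHS]/(_, _) /= scaler0 addr0.
have lQ : linear (fun x : Q => f (0, x)).
  by move=> a x y; rewrite -linearP; congr (f _); rewrite -[RHS]/(_, _) /= scaler0 addr0.
have [h hE] := PP _ _ g (mklin lP) gs.
have [k kE] := QQ _ _ g (mklin lQ) gs.
have lr : linear (fun u : P * Q => h u.1 + k u.2).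
  by move=> a x y; rewrite !linearP scalerDr addrACA.
exists (mklin lr) => -[x y] /=; rewrite linearD hE kE /= -linearD.
by congr (f _); rewrite -[LHS]/(_, _) /= addr0 add0r.
Qed.

Lemma projective_resolution_ex M : exists P : resolution M, proj_resolution P.
Proof.
apply: (@resolution_ex T (fun=> True) (@projective T)) => // {}M _.
have [P [p [PP ps]]] := enough_projectives M.
by have [K [i ip]] := short_exact_ker ps; exists K, P, i, p.
Qed.

Lemma syz_ex n M : exists K, syz n M K.
Proof.
elim: n M => [|n IH] M /=; first by exists M; apply: isomorphic_refl.
have [P [p [PP ps]]] := enough_projectives M.
have [L [i ip]] := short_exact_ker ps; have [K LK] := IH L.
by exists K, L, P, i, p.
Qed.

End FreeModules.

(** * Diagram chases and the tensor functor *)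

Lemma zmod_morphism0 (U V : zmodType) (f : U -> V) : zmod_morphism f -> f 0 = 0.
Proof. by move=> fB; rewrite -(subrr 0) fB subrr. Qed.

Section Chases.
Variables (A3 A2 A1 A0 B3 B2 B1 B0 D3 D2 D1 D0 : zmodType).
Variables (a2 : A2 -> A1) (a1 : A1 -> A0) (b3 : B3 -> B2) (b2 : B2 -> B1)
  (b1 : B1 -> B0) (d3 : D3 -> D2) (d2 : D2 -> D1) (d1 : D1 -> D0).
Variables (u2 : A2 -> B2) (u1 : A1 -> B1) (u0 : A0 -> B0).
Variables (v3 : B3 -> D3) (v2 : B2 -> D2) (v1 : B1 -> D1) (v0 : B0 -> D0).
Hypotheses (b3B : zmod_morphism b3) (b2B : zmod_morphism b2)
  (b1B : zmod_morphism b1) (u1B : zmod_morphism u1) (u0B : zmod_morphism u0)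
  (v2B : zmod_morphism v2) (v1B : zmod_morphism v1) (v0B : zmod_morphism v0).
Hypotheses (ua2 : forall x, u1 (a2 x) = b2 (u2 x))
  (ua1 : forall x, u0 (a1 x) = b1 (u1 x)) (vb3 : forall x, v2 (b3 x) = d3 (v3 x))
  (vb2 : forall x, v1 (b2 x) = d2 (v2 x)) (vb1 : forall x, v0 (b1 x) = d1 (v1 x)).

(** This and the next two chases are the vanishing consequences of the long exact homology sequence,
    one for each position in the short exact sequence of complexes. They are stated for bare
    additive functions so that powers of modules, Hom groups and augmentation terms can all be
    inserted. *)
Lemma chase_middle : exact_at u1 v1 -> injective u0 -> surjective v2 ->
  (forall x, b1 (b2 x) = 0) -> exact_at a2 a1 -> exact_at d2 d1 -> exact_at b2 b1.
Proof.
move=> uv u0I v2s bb ea ed y; split=> [y0|[x <-]] //.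
have /ed [z2 ez] : d1 (v1 y) = 0 by rewrite -vb1 y0 (zmod_morphism0 v0B).
have [x2 ex] := v2s z2.
have /uv [x ux] : v1 (y - b2 x2) = 0 by rewrite v1B vb2 ex ez subrr.
have /ea [w aw] : a1 x = 0.
  by apply: u0I; rewrite ua1 ux b1B bb y0 subrr (zmod_morphism0 u0B).
exists (x2 + u2 w).
by rewrite (morphB_D b2B) -ua2 aw ux addrC subrK.
Qed.

Lemma chase_left : exact_at u2 v2 -> injective u1 -> surjective v3 ->
  (forall x, v1 (u1 x) = 0) -> (forall x, b2 (b3 x) = 0) ->
  (forall x, a1 (a2 x) = 0) ->
  exact_at d3 d2 -> exact_at b2 b1 -> exact_at a2 a1.
Proof.
move=> uv u1I v3s vu bb aa ed eb x; split=> [x0|[y <-]] //.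
have /eb [y ey] : b1 (u1 x) = 0 by rewrite -ua1 x0 (zmod_morphism0 u0B).
have /ed [z ez] : d2 (v2 y) = 0 by rewrite -vb2 ey vu.
have [y3 ey3] := v3s z.
have /uv [w ew] : v2 (y - b3 y3) = 0 by rewrite v2B vb3 ey3 ez subrr.
by exists w; apply: u1I; rewrite ua2 ew b2B bb subr0 ey.
Qed.

End Chases.

Lemma chase_right (A1 A0 Am B2 B1 B0 Bm D2 D1 D0 : zmodType)
    (a1 : A1 -> A0) (a0 : A0 -> Am) (b2 : B2 -> B1) (b1 : B1 -> B0) (b0 : B0 -> Bm)
    (d2 : D2 -> D1) (d1 : D1 -> D0) (u1 : A1 -> B1) (u0 : A0 -> B0) (um : Am -> Bm)
    (v2 : B2 -> D2) (v1 : B1 -> D1) (v0 : B0 -> D0) :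
  zmod_morphism b1 -> zmod_morphism um -> zmod_morphism v1 ->
  (forall x, u0 (a1 x) = b1 (u1 x)) -> (forall x, um (a0 x) = b0 (u0 x)) ->
  (forall x, v1 (b2 x) = d2 (v2 x)) -> (forall x, v0 (b1 x) = d1 (v1 x)) ->
  exact_at u0 v0 -> injective um -> surjective v1 -> surjective v2 ->
  (forall x, v1 (u1 x) = 0) ->
  (forall x, b0 (b1 x) = 0) -> (forall x, d1 (d2 x) = 0) ->
  exact_at a1 a0 -> exact_at b2 b1 -> exact_at d2 d1.
Proof.
move=> b1B umB v1B ua1 ua0 vb2 vb1 uv umI v1s v2s vu bb dd ea eb z.
split=> [z0|[x <-]] //; have [y ey] := v1s z.
have /uv [x ex] : v0 (b1 y) = 0 by rewrite vb1 ey.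
have /ea [w ew] : a0 x = 0.
  by apply: umI; rewrite ua0 ex bb (zmod_morphism0 umB).
have /eb [t et] : b1 (y - u1 w) = 0 by rewrite b1B -ua1 ew ex subrr.
by exists (v2 t); rewrite -vb2 et v1B vu subr0.
Qed.

Section TensorFunctor.
Variables (R S : pzRingType) (C : bimodType R S).

Lemma sum_zmod_morphism (U V : zmodType) (f : U -> V) (I : Type) (r : seq I)
    (F : I -> U) : zmod_morphism f -> f (\sum_(i <- r) F i) = \sum_(i <- r) f (F i).
Proof.
move=> fB; elim: r => [|i r IH]; first by rewrite !big_nil zmod_morphism0.
by rewrite !big_cons (morphB_D fB) IH.
Qed.

Lemma ract_zmodl a : zmod_morphism (fun c : C => ract c a : C).
Proof. by move=> c c'; apply/esym/(addIr (ract c' a)); rewrite subrK -ractDl subrK. Qed.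

Lemma ract_zmodr c : zmod_morphism (fun a : S => ract c a : C).
Proof. by move=> a a'; apply/esym/(addIr (ract c a')); rewrite subrK -ractDr subrK. Qed.

Lemma pure_zmodl (N : lmodType S) x : zmod_morphism (fun c => pure c x : tensor C N).
Proof. by move=> c c'; rewrite -scaleN1r addrC pure_linear scaleN1r addrC. Qed.

Lemma pure_zmodr (N : lmodType S) c : zmod_morphism (pure c : N -> tensor C N).
Proof.
move=> x x'; apply/esym/(addIr (pure c x')).
by rewrite subrK -(balancedDr (pure_balanced C N)) subrK.
Qed.

Lemma tensor_liftB (N : lmodType S) (A : zmodType) (b : C -> N -> A) :
  balanced b -> zmod_morphism (tensor_lift b : tensor C N -> A).
Proof.
by move=> bb u v; rewrite [LHS](tensor_liftD bb) [X in _ + X](tensor_liftN bb).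
Qed.

Lemma eq_tensor_morphism (N : lmodType S) (A : zmodType) (f g : tensor C N -> A) :
  zmod_morphism f -> zmod_morphism g ->
  (forall c x, f (pure c x) = g (pure c x)) -> f =1 g.
Proof.
move=> fB gB e u; have [s ->] := tensor_sumE u.
by rewrite !sum_zmod_morphism //; apply: eq_bigr.
Qed.

Lemma balanced_comp (N N' : lmodType S) (f : {linear N -> N'}) (A : zmodType)
    (b : C -> N' -> A) : balanced b -> balanced (fun c x => b c (f x)).
Proof.
move=> [Dl Dr M]; split=> [c c' x|c x x'|c a x]; first exact: Dl.
- by rewrite linearD Dr.
- by rewrite linearZ M.
Qed.

Lemma tensor_mapB (N N' : lmodType S) (f : {linear N -> N'}) :
  zmod_morphism (tensor_map C f).
Proof. by apply: tensor_liftB; apply: balanced_comp; apply: pure_balanced. Qed.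

Lemma tensor_map_linear (N N' : lmodType S) (f : {linear N -> N'}) :
  linear (tensor_map C f).
Proof.
move=> a u v; rewrite (morphB_D (@tensor_mapB _ _ f)); congr (_ + _).
apply: (eq_tensor_morphism (f := fun u => tensor_map C f (a *: u))
  (g := fun u => a *: tensor_map C f u)) => [x y|x y|c x].
- by rewrite scalerBr tensor_mapB.
- by rewrite tensor_mapB scalerBr.
- by rewrite pureZ !tensor_mapE pureZ.
Qed.

Definition tmap (N N' : lmodType S) (f : {linear N -> N'}) :
  {linear tensor C N -> tensor C N'} := mklin (@tensor_map_linear N N' f).

Lemma tensor_map_comp (N N' N'' : lmodType S) (g : {linear N' -> N''})
    (f : {linear N -> N'}) (h : {linear N -> N''}) :
  (forall x, h x = g (f x)) ->
  forall u, tensor_map C h u = tensor_map C g (tensor_map C f u).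
Proof.
move=> e; apply: eq_tensor_morphism => [|x y|c x]; first exact: tensor_mapB.
- by rewrite !tensor_mapB.
- by rewrite !tensor_mapE e.
Qed.

Lemma tensor_map_surj (N N' : lmodType S) (f : {linear N -> N'}) :
  surjective f -> surjective (tensor_map C f).
Proof.
move=> /choice [s sE] u; have [r ->] := tensor_sumE u.
exists (\sum_(p <- r) pure p.1 (s p.2)).
rewrite sum_zmod_morphism; last exact: tensor_mapB.
by apply: eq_bigr => p _; rewrite tensor_mapE sE.
Qed.

End TensorFunctor.

(** * Tor from a free resolution of C *)

(** Tensoring a matrix map of free right modules with [N], after identifying S^m (x) N with
    ['I_m -> N]. For [N = S^o] it is the matrix map itself. *)
Definition mxact (S : pzRingType) (m n : nat) (D : 'I_m -> 'I_n -> S)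
  (N : lmodType S) (x : 'I_m -> N) : 'I_n -> N :=
  fun a => \sum_i D i a *: x i.

(* A resolution of C_S by finitely generated free right modules, given by the
   images [frgen] of the basis of the 0-th term and by the matrices [frmx]. *)
Record free_resolution (R S : pzRingType) (C : bimodType R S) := FreeResolution {
  frk : nat -> nat;
  frmx : forall j, 'I_(frk j.+1) -> 'I_(frk j) -> S;
  frgen : 'I_(frk 0) -> C;
  frgenP : forall c, exists s : 'I_(frk 0) -> S, c = \sum_a ract (frgen a) (s a);
  frrel : exact_at (mxact (frmx (j := 0)) (N := S^o))
    (fun s : 'I_(frk 0) -> S^o => \sum_a ract (frgen a) (s a));
  frexact : forall j, exact_at (mxact (frmx (j := j.+1)) (N := S^o))
    (mxact (frmx (j := j)) (N := S^o)) }.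

Section Tor.
Variables (R S : pzRingType) (C : bimodType R S) (F : free_resolution C).
Local Notation k := (frk F).
Implicit Types A B D N P : lmodType S.

Definition td j N (x : 'I_(k j.+1) -> N) : 'I_(k j) -> N := mxact (frmx (f := F) (j := j)) x.

Definition taug N (x : 'I_(k 0) -> N) : tensor C N :=
  \sum_a pure (frgen a) (x a).

Lemma mxactB m n (M : 'I_m -> 'I_n -> S) N : zmod_morphism (mxact M (N := N)).
Proof.
move=> x y; apply/funext => a; rewrite -[RHS]/(_ - _) -sumrB.
by apply: eq_bigr => i _; rewrite -scalerBr.
Qed.

Lemma tdB j N : zmod_morphism (@td j N). Proof. exact: mxactB. Qed.

Lemma taugB N : zmod_morphism (@taug N).
Proof.
by move=> x y; rewrite /taug -sumrB; apply: eq_bigr => a _; rewrite -pure_zmodr.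
Qed.

Lemma td_map j N N' (f : {linear N -> N'}) (x : 'I_(k j.+1) -> N) :
  f \o td x = td (f \o x).
Proof. by apply/funext => a; rewrite /= linear_sum; apply: eq_bigr => i _; rewrite linearZ. Qed.

Lemma taug_map N N' (f : {linear N -> N'}) (x : 'I_(k 0) -> N) :
  tensor_map C f (taug x) = taug (f \o x).
Proof.
rewrite sum_zmod_morphism; last exact: tensor_mapB.
by apply: eq_bigr => a _; rewrite tensor_mapE.
Qed.

Let delta m (i : 'I_m) : 'I_m -> S^o := fun j => (j == i)%:R.

Lemma mxact_delta m n (M : 'I_m -> 'I_n -> S) i a :
  mxact M (N := S^o) (delta i) a = M i a.
Proof.
rewrite /mxact (bigD1 i) //= /delta eqxx big1 ?addr0 => [|j /negPf ->].
  by rewrite -[LHS]/(_ * _) mulr1.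
by rewrite scaler0.
Qed.

(** Exactness is given over [S] only; on basis vectors it says that consecutive matrices multiply to
    zero, and this passes to every [N]. *)
Lemma td_td j N (x : 'I_(k j.+2) -> N) : td (td x) = 0.
Proof.
have DD i a : \sum_b frmx (f := F) b a * frmx (f := F) (j := j.+1) i b = 0.
  have : td (td (delta (m := k j.+2) i)) = 0 :> (_ -> S^o).
    by apply: (exact_comp0 _ (@frexact _ _ _ F j)).
  move=> /(congr1 (fun f => f a)) e; rewrite -[RHS]e; apply: eq_bigr => b _.
  by rewrite /td mxact_delta.
apply/funext => a; rewrite /td /mxact.
under eq_bigr => b _ do rewrite scaler_sumr.
rewrite exchange_big big1 //= => i _.
by under eq_bigr => b _ do rewrite scalerA; rewrite -scaler_suml DD scale0r.
Qed.

Lemma frgen_rel i : \sum_a ract (frgen a) (frmx (f := F) (j := 0) i a) = 0.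
Proof.
have := exact_comp0 (delta i) (@frrel _ _ _ F) => /= e; rewrite -[RHS]e.
by apply: eq_bigr => a _; rewrite mxact_delta.
Qed.

Lemma taug_td N (x : 'I_(k 1) -> N) : taug (td x) = 0.
Proof.
rewrite /taug /td /mxact.
under eq_bigr => a _.
  rewrite (sum_zmod_morphism _ _ (@pure_zmodr _ _ C N _)).
  under eq_bigr => i _ do rewrite -(balancedM (pure_balanced C N)).
  over.
rewrite exchange_big big1 //= => i _.
rewrite -(sum_zmod_morphism _ _ (@pure_zmodl _ _ C N (x i))) frgen_rel.
exact: (zmod_morphism0 (@pure_zmodl _ _ C N (x i))).
Qed.

Lemma taug_surj N : surjective (@taug N).
Proof.
move=> u; have [s ->] := tensor_sumE u.
have one (c : C) (x : N) : exists y, taug y = pure c x.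
  have [t ->] := frgenP F c; exists (fun a => t a *: x).
  rewrite (sum_zmod_morphism _ _ (@pure_zmodl _ _ C N x)).
  by apply: eq_bigr => a _; rewrite (balancedM (pure_balanced C N)).
elim: s => [|[c x] s [y IH]].
  by exists 0; rewrite big_nil (zmod_morphism0 (@taugB N)).
have [z ez] := one c x; exists (z + y).
by rewrite big_cons (morphB_D (@taugB N)) IH ez.
Qed.

(** Right exactness of - (x) N at the presentation of [C], proved by constructing the inverse map
    from C (x) N to the cokernel of [td]. *)
Lemma taug_exact N : exact_at (@td 0 N) (@taug N).
Proof.
move=> y; split=> [y0|[x <-]]; last exact: taug_td.
(* Over a noncommutative [S] the image of [td] is only a subgroup, so the quotient is taken over
   [int]. *)
have sI : submodule (fun z : zmodule ('I_(k 0) -> N) => exists x, @td 0 N x = z).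
  split=> [|a _ _ [x <-] [x' <-]].
    by exists 0; rewrite (zmod_morphism0 (@tdB 0 N)).
  exists (x *~ a + x'); rewrite (morphB_D (@tdB 0 N)); congr (_ + _).
  have tn n : td (x *+ n) = td x *+ n.
    elim: n => [|n IH]; first exact: (zmod_morphism0 (@tdB 0 N)).
    by rewrite !mulrS (morphB_D (@tdB 0 N)) IH.
  case: a => n; rewrite -[RHS]/(td x *~ _) ?NegzE ?mulrNz -!pmulrn //.
  by rewrite -sub0r tdB tn (zmod_morphism0 (@tdB 0 N)) sub0r.
have [Q [q [_ qE]]] := quotient_ex sI.
have q0 z : q z = 0 <-> exists x, @td 0 N x = z by exact: qE.
have [s sE] := choice (@frgenP _ _ _ F).
(* Two coordinate vectors of one element of [C] differ by a relation, and relations vanish in [Q]: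
   the choice [s] of coordinates becomes harmless. *)
have rel (r : 'I_(k 0) -> S) x : \sum_a ract (frgen a) (r a) = 0 ->
    q (fun a => r a *: x) = 0.
  move=> /(@frrel _ _ _ F r) [t et]; apply/q0; exists (fun i => (t i : S) *: x).
  apply/funext => a; rewrite -et /td /mxact scaler_suml.
  by apply: eq_bigr => i _; rewrite scalerA.
pose b c x : Q := q (fun a => s c a *: x).
have qD (f g h : 'I_(k 0) -> N) : h = f + g -> q h = q f + q g.
  by move=> ->; rewrite -[_ + _]/((f : zmodule _) + (g : zmodule _)) linearD.
have qE2 (f g h : 'I_(k 0) -> N) : q h = 0 -> f = g + h -> q f = q g.
  by move=> h0 /qD ->; rewrite h0 addr0.
have bb : balanced b.
  split=> [c c' x|c x x'|c a x].
  - have e : q (fun a => (s (c + c') a - s c a - s c' a) *: x) = 0.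
      apply: rel; under eq_bigr => a _ do rewrite !ract_zmodr.
      by rewrite !sumrB -!sE [c + c']addrC addrK subrr.
    rewrite /b -(qD _ _ _ erefl); apply: (qE2 _ _ _ e); apply/funext => a.
    rewrite -[RHS]/(s c a *: x + s c' a *: x + (s (c + c') a - s c a - s c' a) *: x).
    have es : s c a + s c' a + (s (c + c') a - s c a - s c' a) = s (c + c') a.
      by rewrite addrC -[_ - _ - _]addrA -opprD subrK.
    by rewrite -!scalerDl es.
  - by rewrite /b; apply: qD; apply/funext => a; rewrite scalerDr.
  - have e : q (fun b => (s (ract c a) b - s c b * a) *: x) = 0.
      apply: rel; under eq_bigr => i _ do rewrite ract_zmodr -ractA.
      by rewrite sumrB -sE -(sum_zmod_morphism _ _ (@ract_zmodl _ _ C a)) -sE subrr.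
    rewrite /b; apply: (qE2 _ _ _ e); apply/funext => i.
    rewrite -[RHS]/(s c i *: (a *: x) + (s (ract c a) i - s c i * a) *: x).
    by rewrite scalerA -scalerDl addrC subrK.
have : tensor_lift b (taug y) = 0 by rewrite y0; apply: tensor_lift0.
rewrite sum_zmod_morphism; last exact: tensor_liftB.
move=> e; have /q0 // : q y = 0.
rewrite -[RHS]e.
have -> : q y = \sum_a q (fun i => (delta a i : S) *: y a).
  have qB : zmod_morphism (q : ('I_(k 0) -> N) -> Q).
    by move=> f g; rewrite -[f - g]/((f : zmodule _) - (g : zmodule _)) linearB.
  rewrite -(sum_zmod_morphism _ _ qB); congr (q _); apply/funext => i.
  rewrite fct_sumE (bigD1 i) //= /delta eqxx scale1r big1 ?addr0 // => j.
  by rewrite eq_sym => /negPf ->; rewrite scale0r.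
apply: eq_bigr => a _; rewrite tensor_liftE //.
(* The coordinates chosen for [frgen a] need not be the basis vector [delta a], but the difference
   is a relation. *)
have e1 : q (fun i => ((delta a i : S) - s (frgen a) i) *: y a) = 0.
  apply: rel; under eq_bigr => i _ do rewrite ract_zmodr.
  rewrite sumrB -sE (bigD1 a) //= {1}/delta eqxx ract1 big1 ?addr0 ?subrr //.
  move=> i /negPf ia; rewrite /delta ia.
  exact: (zmod_morphism0 (@ract_zmodr _ _ C (frgen i))).
apply: (qE2 _ _ _ e1); apply/funext => i.
rewrite -[RHS]/(s (frgen a) i *: y a + ((delta a i : S) - s (frgen a) i) *: y a).
by rewrite -scalerDl addrC subrK.
Qed.

End Tor.

Section TorVanishing.
Variables (R S : pzRingType) (C : bimodType R S) (F : free_resolution C).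
Local Notation k := (frk F).
Implicit Types A B D K M N P : lmodType S.

(* Vanishing of [Tor_(j+1)(C, N)], computed from a resolution of C. *)
Definition tor_ex j N := exact_at (@td _ _ _ F j.+1 N) (@td _ _ _ F j N).

(** Lift an element killed by C (x) g to a vector [y] over [B]. Then [g \o y] lies in the image of
    [td]; correcting [y] by a lift of a preimage brings it into the image of [f] coordinatewise. *)
Lemma tensor_map_exact A B D (f : {linear A -> B}) (g : {linear B -> D}) :
  exact_at f g -> surjective g -> exact_at (tensor_map C f) (tensor_map C g).
Proof.
move=> fg gs u; split=> [u0|[v <-]]; last first.
  rewrite -(tensor_map_comp (h := \0 : {linear A -> D})) => [|x].
    have e := @eq_tensor_morphism _ _ C A _ (tensor_map C \0) (fun=> 0).
    apply: e => [|x y|c x]; [exact: tensor_mapB|by rewrite subr0|].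
    by rewrite tensor_mapE (zmod_morphism0 (@pure_zmodr _ _ C D c)).
  by rewrite (exact_comp0 _ fg).
have [y ey] := taug_surj F u.
have /(@taug_exact _ _ _ F) [w ew] : taug (F := F) (g \o y) = 0 by rewrite -taug_map ey.
have /choice [r rE] := gs.
have [z ez] : exists z, g \o (y - td (F := F) z) = 0.
  exists (r \o w); apply/funext => a; rewrite /= linearB -[LHS]/((g \o y) a - (g \o td (r \o w)) a).
  by rewrite td_map -ew (_ : g \o (r \o w) = w) ?subrr //; apply/funext => i; apply: rE.
have /choice [x xE] : forall a, exists x, f x = (y - td (F := F) z) a.
  by move=> a; apply/fg; rewrite -[LHS]/((g \o (y - td (F := F) z)) a) ez.
exists (taug (F := F) x); rewrite taug_map (_ : f \o x = y - td (F := F) z); last exact/funext.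
by rewrite taugB taug_td subr0.
Qed.

(** * Long exact sequence of Tor *)

Section Columns.
Variables (A B D : lmodType S) (f : {linear A -> B}) (g : {linear B -> D}).
Hypothesis fg : short_exact f g.
Let pf I (x : I -> A) : I -> B := f \o x.
Let pg I (x : I -> B) : I -> D := g \o x.

Let pfB I : zmod_morphism (@pf I).
Proof. by move=> x y; apply/funext => i; rewrite /pf /= linearB. Qed.

Let pgB I : zmod_morphism (@pg I).
Proof. by move=> x y; apply/funext => i; rewrite /pg /= linearB. Qed.

Let pfg I : exact_at (@pf I) (@pg I).
Proof.
case: fg => _ e _ y; split=> [y0|[x <-]]; last first.
  by apply/funext => i; rewrite /pg /pf /= (exact_comp0 _ e).
have /choice [x xE] : forall i, exists x, f x = y i.
  by move=> i; apply/e; rewrite -[LHS]/(pg y i) y0.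
by exists x; apply/funext.
Qed.

Let pfI I : injective (@pf I).
Proof.
by case: fg => fI _ _ x y e; apply/funext => i; apply: fI; rewrite -[LHS]/(pf x i) e.
Qed.

Let pgs I : surjective (@pg I).
Proof.
by case: fg => _ _ /choice [r rE] y; exists (r \o y); apply/funext => i; apply: rE.
Qed.

Let pg0 I (x : I -> A) : pg (pf x) = 0.
Proof. exact: (exact_comp0 x (@pfg I)). Qed.

Let pf_td j (x : 'I_(k j.+1) -> A) : pf (td x) = td (pf x).
Proof. exact: td_map. Qed.

Let pg_td j (x : 'I_(k j.+1) -> B) : pg (td x) = td (pg x).
Proof. exact: td_map. Qed.

Lemma tor_middle j : tor_ex j A -> tor_ex j D -> tor_ex j B.
Proof.
apply: (chase_middle (@tdB _ _ _ F j.+1 B) (@tdB _ _ _ F j B) (@pfB _) (@pgB _)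
  (@pgB _) (@pf_td _) (@pf_td _) (@pg_td _) (@pg_td _) (@pfg _) (@pfI _) (@pgs _)).
exact: td_td.
Qed.

Lemma tor_left j : tor_ex j.+1 D -> tor_ex j B -> tor_ex j A.
Proof.
apply: (chase_left (@tdB _ _ _ F j.+1 B) (@pfB _) (@pgB _) (@pf_td _) (@pf_td _)
  (@pg_td _) (@pg_td _) (@pfg _) (@pfI _) (@pgs _) (@pg0 _)); exact: td_td.
Qed.

Lemma tor_right j : tor_ex j A -> tor_ex j.+1 B -> tor_ex j.+1 D.
Proof.
apply: (chase_right (@tdB _ _ _ F j.+1 B) (@pfB _) (@pgB _) (@pf_td _) (@pf_td _)
  (@pg_td _) (@pg_td _) (@pfg _) (@pfI _) (@pgs _) (@pgs _) (@pg0 _)); exact: td_td.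
Qed.

(** The lowest case of [tor_right]: the complex of [A] is continued by its augmentation to C (x) A,
    where [taug_exact] holds. *)
Lemma tor_right0 : injective (tensor_map C f) -> tor_ex 0 B -> tor_ex 0 D.
Proof.
move=> fI; apply: (chase_right (@tdB _ _ _ F 0 B) (@tensor_mapB _ _ _ _ _ f) (@pgB _)
  (@pf_td _) (@taug_map _ _ _ F A B f) (@pg_td _) (@pg_td _) (@pfg _) fI (@pgs _)
  (@pgs _) (@pg0 _) _ _ (@taug_exact _ _ _ F A)).
  exact: taug_td.
exact: td_td.
Qed.

Lemma tensor_map_inj : tor_ex 0 D -> injective (tensor_map C f).
Proof.
move=> t0; apply: (@linear_inj _ _ _ (tmap C f)) => u /= u0.
have [y ey] := taug_surj F u; move: u0; rewrite -ey taug_map => u0.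
(* The complex of [A] is closed with C (x) B in place of C (x) A. Exactness there says that a vector
   whose class dies in C (x) B already comes from [td], hence has class zero in C (x) A. *)
have ex : exact_at (@td _ _ _ F 0 A) (fun x => taug (F := F) (pf x)).
  apply: (chase_left (u0 := id) (@tdB _ _ _ F 0 B) _ (@pgB _) (@pf_td _) _
    (@pg_td _) (@pg_td _) (@pfg _) (@pfI _) (@pgs _) (@pg0 _) _ _ t0
    (@taug_exact _ _ _ F B)) => // x; first exact: td_td.
  by rewrite pf_td taug_td.
by have /ex [x <-] := u0; rewrite taug_td.
Qed.

Lemma tensor_short_exact : tor_ex 0 D -> short_exact (tmap C f) (tmap C g).
Proof.
move=> t0; case: fg => fI e gs; split; first exact: tensor_map_inj.
- exact: tensor_map_exact.
- exact: tensor_map_surj.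
Qed.

End Columns.

(** A cycle has finitely many entries, so a finite dual basis writes it through cycles over [S],
    which bound by exactness of the resolution of [C]. *)
Lemma tor_projective j P : projective P -> tor_ex j P.
Proof.
move=> PP x; split=> [x0|[y <-]]; last exact: td_td.
have [b bE] := projective_dual_basis (codom x) PP.
have xE i : x i = \sum_(q <- b) (q.1 (x i) : S) *: q.2 by apply: bE; apply: codom_f.
have /choice [y yE] (q : {linear P -> S^o} * P) : exists y, td (F := F) y = q.1 \o x.
  apply/(@frexact _ _ _ F); rewrite -[LHS]/(td (F := F) (q.1 \o x)) -td_map x0.
  by apply/funext => i; rewrite /= linear0.
exists (fun i => \sum_(q <- b) (y q i : S) *: q.2); apply/funext => a.
rewrite [RHS]xE /td /mxact; under eq_bigr => i _ do rewrite scaler_sumr.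
rewrite exchange_big; apply: eq_bigr => q _ /=.
rewrite -[q.1 (x a)]/((q.1 \o x) a) -yE /td /mxact scaler_suml.
by apply: eq_bigr => i _; rewrite scalerA.
Qed.

(** Balance of Tor by dimension shifting along [P]. In lowest degree both sides say that C (x) K ->
    C (x) P_0 is injective, for [K] the first syzygy of [N]. *)
Lemma TorE j N (P : resolution N) : proj_resolution P ->
  exact_at (tensor_map C (res_d P j.+1)) (tensor_map C (res_d P j)) <-> tor_ex j N.
Proof.
elim: j N P => [|j IH] N P PP.
  have [K [i [a [ip sa ea aE]]]] := res_tail_ex P.
  have aE' u : tensor_map C (res_d P 0) u = tensor_map C i (tensor_map C a u).
    by apply: tensor_map_comp => x; rewrite aE.
  have exa := tensor_map_exact ea sa.
  have t0 : tor_ex 0 N <-> injective (tensor_map C i).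
    split=> [|iI]; first exact: tensor_map_inj ip.
    by apply: (tor_right0 ip iI); apply: tor_projective.
  rewrite t0; split=> [ex|iI].
    apply: (@linear_inj _ _ _ (tmap C i)) => u /= u0.
    have [v ev] := tensor_map_surj (C := C) sa u.
    by move: u0; rewrite -ev -aE' => /ex /exa.
  move=> u; rewrite aE' -exa; split=> [e|->].
    by apply: (linear_inj0 (f := tmap C i)).
  exact: (linear0 (tmap C i)).
have [K [i [a [ip sa ea _]]]] := res_tail_ex P.
rewrite (IH K (res_tail sa ea)) => [|n]; last exact: PP.
split=> t.
  by apply: (tor_right ip) => //; apply: tor_projective.
by apply: (tor_left ip) => //; apply: tor_projective.
Qed.

Lemma Tor_zeroP j N : Tor_zero j.+1 C N <-> tor_ex j N.
Proof.
split=> [t|t P PP]; last exact/TorE.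
by have [P PP] := projective_resolution_ex N; apply/(TorE j PP)/t.
Qed.

Lemma tor_syz n N K : syz n N K -> (forall j, tor_ex j K) ->
  forall j, (n <= j)%N -> tor_ex j N.
Proof.
move=> nNK tK; elim: n N nNK => [|n IH] N /=.
  move=> [f fb] j _; have [Z Z0] := zero_module_ex S.
  have sf : short_exact f (\0 : {linear N -> Z}).
    split; first exact: bij_inj.
      by move=> x; split=> // _; apply: bij_surj.
    by move=> z; exists 0; rewrite (Z0 z).
  by apply: (tor_middle sf) => //; apply: tor_projective; apply: zero_projective.
move=> [L [P [f [g [fg PP /IH tL]]]]] [|j] // nj.
by apply: (tor_right fg); [exact: tL | exact: tor_projective].
Qed.

End TorVanishing.

(** * Ext *)

Section Ext.
Variable T : pzRingType.
Implicit Types A B D I K L M N P X Y : lmodType T.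

Definition postcomp L M N (f : {linear M -> N}) (h : Hom L M) : Hom L N :=
  f \o (h : {linear L -> M}) : {linear L -> N}.

Lemma precompB L M X (f : {linear L -> M}) : zmod_morphism (precomp (X := X) f).
Proof. by move=> g h; apply: HomP. Qed.

Lemma postcompB L M N (f : {linear M -> N}) : zmod_morphism (@postcomp L M N f).
Proof. by move=> g h; apply: HomP => x; rewrite /= linearB. Qed.

Lemma precomp0 L M X (f : {linear L -> M}) (h : Hom M X) :
  precomp f h = 0 <-> forall x, (h : {linear M -> X}) (f x) = 0.
Proof.
split=> [e x|e]; last exact: HomP.
by rewrite -[LHS]/((precomp f h : {linear L -> X}) x) e.
Qed.

Lemma res_dd L (P : resolution L) i x : res_d P i (res_d P i.+1 x) = 0.
Proof. exact: (exact_comp0 x (@res_exact _ _ P i)). Qed.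

(** The map [d] need not be injective: [h] descends to the image of [d] and is extended from
    there. *)
Lemma injective_extend X Y I (d : {linear X -> Y}) (h : {linear X -> I}) :
  injective_module I -> (forall x, d x = 0 -> h x = 0) ->
  exists h' : {linear Y -> I}, forall x, h' (d x) = h x.
Proof.
move=> II hd.
have [|K [i [iI iE]]] := @submodule_ex T Y (fun y => exists x, d x = y).
  split=> [|a _ _ [x <-] [y <-]]; first by exists 0; rewrite linear0.
  by exists (a *: x + y); rewrite linearP.
have [|a aE] := lift_inj (f := d) iI; first by move=> x; apply/iE; exists x.
have as_ : surjective a.
  move=> z; have /iE [x ex] : exists z', i z' = i z by exists z.
  by exists x; apply: iI; rewrite aE.
have [|h1 h1E] := factor_surj (f := h) as_.
  by move=> x e; apply: hd; rewrite -aE e linear0.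
have [h' h'E] := II _ _ i h1 iI.
by exists h' => x; rewrite -aE h'E h1E.
Qed.

Section Complex.
Variables (L : lmodType T) (P : resolution L).

(* Vanishing of [Ext^(j+1)(L, M)], computed from the resolution P. *)
Definition ext_ex j M :=
  exact_at (precomp (X := M) (res_d P j)) (precomp (res_d P j.+1)).

Lemma precomp_dd j M (h : Hom (P j) M) : precomp (res_d P j.+1) (precomp (res_d P j) h) = 0.
Proof. by apply/precomp0 => x; rewrite /= res_dd linear0. Qed.

Lemma precomp_aug_exact M :
  exact_at (precomp (X := M) (res_aug P)) (precomp (res_d P 0)).
Proof.
move=> h; split=> [/precomp0 h0|[g <-]]; last first.
  by apply/precomp0 => x; rewrite /= (exact_comp0 x (@res_exact0 _ _ P)) linear0.
have [|g gE] := factor_surj (f := h : {linear _ -> _}) (@res_surj _ _ P).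
  by move=> x /(@res_exact0 _ _ P) [y <-]; apply: h0.
by exists g; apply: HomP.
Qed.

Lemma ext_injective j I : injective_module I -> ext_ex j I.
Proof.
move=> II h; split=> [/precomp0 h0|[g <-]]; last exact: precomp_dd.
have [|g gE] := injective_extend (d := res_d P j) (h := h : {linear _ -> _}) II.
  by move=> x /(@res_exact _ _ P) [y <-]; apply: h0.
by exists g; apply: HomP.
Qed.

Section Columns.
Variables (A B D : lmodType T) (f : {linear A -> B}) (g : {linear B -> D}).
Hypothesis fg : short_exact f g.

Lemma postcomp_inj M : injective (@postcomp M A B f).
Proof.
case: fg => fI _ _ h k e; apply: HomP => x; apply: fI.
by rewrite -[LHS]/((postcomp f h : {linear M -> B}) x) e.
Qed.

Lemma postcomp_exact M : exact_at (@postcomp M A B f) (@postcomp M B D g).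
Proof.
case: fg => fI e _ h; split=> [h0|[k <-]]; last first.
  by apply: HomP => x; rewrite /= (exact_comp0 _ e).
have [|k kE] := lift_inj (f := h : {linear _ -> _}) fI; last by exists k; apply: HomP.
by move=> x; apply/e; rewrite -[LHS]/((postcomp g h : {linear M -> D}) x) h0.
Qed.

Lemma postcomp0 M (h : Hom M A) : postcomp g (postcomp f h) = 0.
Proof. exact: (exact_comp0 h (@postcomp_exact M)). Qed.

Lemma postcomp_surj M : projective M -> surjective (@postcomp M B D g).
Proof.
case: fg => _ _ gs PM h; have [k kE] := PM _ _ g (h : {linear _ -> _}) gs.
by exists k; apply: HomP.
Qed.

Hypothesis PP : proj_resolution P.

Let pc M N (d : {linear M -> N}) (X Y : lmodType T) (u : {linear X -> Y}) (h : Hom N X) :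
  postcomp u (precomp d h) = precomp d (postcomp u h).
Proof. exact: HomP. Qed.

Lemma ext_middle j : ext_ex j A -> ext_ex j D -> ext_ex j B.
Proof.
apply: (chase_middle (@precompB _ _ _ _) (@precompB _ _ _ _)
  (@postcompB _ _ _ _) (@postcompB _ _ _ _) (@postcompB _ _ _ _)
  (@pc _ _ _ _ _ _) (@pc _ _ _ _ _ _) (@pc _ _ _ _ _ _) (@pc _ _ _ _ _ _)
  (@postcomp_exact _) (@postcomp_inj _) (@postcomp_surj _ (@PP _))).
exact: precomp_dd.
Qed.

Lemma ext_left j : ext_ex j D -> ext_ex j.+1 B -> ext_ex j.+1 A.
Proof.
apply: (chase_left (@precompB _ _ _ _) (@postcompB _ _ _ _) (@postcompB _ _ _ _)
  (@pc _ _ _ _ _ _) (@pc _ _ _ _ _ _) (@pc _ _ _ _ _ _) (@pc _ _ _ _ _ _)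
  (@postcomp_exact _) (@postcomp_inj _) (@postcomp_surj _ (@PP _)) (@postcomp0 _));
  exact: precomp_dd.
Qed.

Lemma ext_left0 : surjective (@postcomp L B D g) -> ext_ex 0 B -> ext_ex 0 A.
Proof.
move=> gs; apply: (chase_left (@precompB _ _ _ _) (@postcompB _ _ _ _)
  (@postcompB _ _ _ _)
  (@pc _ _ _ _ _ _) (@pc _ _ _ _ _ _) (@pc _ _ _ _ _ _) (@pc _ _ _ _ _ _)
  (@postcomp_exact _) (@postcomp_inj _) gs (@postcomp0 _) _ _
  (@precomp_aug_exact D)); last exact: precomp_dd.
by move=> h; apply: (exact_comp0 h (@precomp_aug_exact B)).
Qed.

Lemma ext_right j : ext_ex j.+1 A -> ext_ex j B -> ext_ex j D.
Proof.
apply: (chase_right (@precompB _ _ _ _) (@postcompB _ _ _ _) (@postcompB _ _ _ _)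
  (@pc _ _ _ _ _ _) (@pc _ _ _ _ _ _) (@pc _ _ _ _ _ _) (@pc _ _ _ _ _ _)
  (@postcomp_exact _) (@postcomp_inj _) (@postcomp_surj _ (@PP _))
  (@postcomp_surj _ (@PP _)) (@postcomp0 _)); exact: precomp_dd.
Qed.

(** Lift P_0 -> L -> D to [B]. The failure of the lift to factor through [L] is a cocycle with
    values in [A], and subtracting a cochain that bounds it repairs the lift. *)
Lemma ext_hom_surj : ext_ex 0 A -> surjective (@postcomp L B D g).
Proof.
move=> eA h; have [y ey] := postcomp_surj (@PP 0%N) (precomp (res_aug P) h).
have /postcomp_exact [x ex] : postcomp g (precomp (res_d P 0) y) = 0.
  by rewrite pc ey; apply: (exact_comp0 h (@precomp_aug_exact D)).
have /eA [z ez] : precomp (res_d P 1) x = 0.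
  by apply: (@postcomp_inj _); rewrite pc ex precomp_dd (zmod_morphism0 (@postcompB _ _ _ f)).
have /precomp_aug_exact [k ek] : precomp (res_d P 0) (y - postcomp f z) = 0.
  by rewrite precompB -pc ez ex subrr.
exists k; apply: HomP => l; have [p <-] := @res_surj _ _ P l.
rewrite -[LHS]/((postcomp g (precomp (res_aug P) k) : {linear P 0%N -> D}) p) ek.
by rewrite postcompB postcomp0 subr0 ey.
Qed.

End Columns.
End Complex.

(** For [M] embedded in an injective with cokernel [D], vanishing in degree 1 is tied to
    surjectivity of Hom(L, I) -> Hom(L, D), which mentions no resolution; higher degrees are shifted
    from [M] to [D]. *)
Lemma ext_indep L (P Q : resolution L) j M :
  proj_resolution P -> proj_resolution Q -> ext_ex P j M -> ext_ex Q j M.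
Proof.
move=> PP QQ; elim: j M => [|j IH] M eM;
  have [I [i [II iI]]] := enough_injectives M;
  have [D [p ip]] := short_exact_coker iI.
  apply: (ext_left0 ip); last exact: ext_injective.
  exact: (ext_hom_surj ip PP).
apply: (ext_left ip QQ); last exact: ext_injective.
by apply: IH; apply: (ext_right ip PP eM); apply: ext_injective.
Qed.
End Ext.

(** * The Auslander class *)

Lemma Ext_zeroP (T : pzRingType) (L M : lmodType T) (P : resolution L) j :
  proj_resolution P -> Ext_zero j.+1 L M <-> ext_ex P j M.
Proof.
by move=> PP; split=> [|e Q QQ]; [apply | apply: (ext_indep PP QQ e)].
Qed.

Section AuslanderClass.
Variables (R S : pzRingType) (C : bimodType R S) (F : free_resolution C).
Variables (P : resolution C) (PP : proj_resolution P).
Implicit Types A B D N : lmodType S.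

Lemma auslanderP N : auslander C N <->
  [/\ forall j, tor_ex F j N, forall j, ext_ex P j (tensor C N)
    & bijective (@mu R S C N)].
Proof.
split=> [[t e b]|[t e b]]; split=> //.
- by move=> j; apply/Tor_zeroP/t.
- by move=> j; apply/(Ext_zeroP _ _ PP)/e.
- by case=> // j _; apply/Tor_zeroP/t.
- by case=> // j _; apply/(Ext_zeroP _ _ PP)/e.
Qed.

Lemma muB N : zmod_morphism (@mu R S C N).
Proof.
by move=> x y; apply: HomP => c; apply: pure_zmodr.
Qed.

Lemma mu_natural N N' (f : {linear N -> N'}) x :
  postcomp (tmap C f) (mu C x) = mu C (f x).
Proof. by apply: HomP => c; apply: tensor_mapE. Qed.

Section ShortExact.
Variables (A B D : lmodType S) (f : {linear A -> B}) (g : {linear B -> D}).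
Hypothesis fg : short_exact f g.

Lemma auslander_middle : auslander C A -> auslander C D -> auslander C B.
Proof.
move=> /auslanderP [tA eA mA] /auslanderP [tD eD mD]; apply/auslanderP.
have sx := tensor_short_exact fg (tD 0%N).
split=> [j|j|]; [exact: tor_middle fg _ _ _ | exact: ext_middle sx PP _ _ _|].
case: fg => _ fgE gs; apply: inj_surj_bij.
  suff inj0 (b : B) : mu C b = 0 -> b = 0.
    by move=> x y e; apply/subr0_eq/inj0; rewrite muB e subrr.
  move=> b0; have /fgE [a ea] : g b = 0.
    apply: (bij_inj mD); rewrite -mu_natural b0 (zmod_morphism0 (@postcompB _ _ _ _ _)).
    by rewrite (zmod_morphism0 (@muB _)).
  suff a0 : a = 0 by rewrite -ea a0 linear0.
  apply: (bij_inj mA); apply: (postcomp_inj sx).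
  by rewrite mu_natural ea b0 (zmod_morphism0 (@muB _)) (zmod_morphism0 (@postcompB _ _ _ _ _)).
move=> h; have [d ed] := bij_surj mD (postcomp (tmap C g) h).
have [b eb] := gs d.
have /(postcomp_exact sx) [k ek] : postcomp (tmap C g) (h - mu C b) = 0.
  by rewrite postcompB mu_natural eb ed subrr.
have [a ea] := bij_surj mA k.
by exists (f a + b); rewrite (morphB_D (@muB _)) -mu_natural ea ek subrK.
Qed.

(** Surjectivity of Hom(C, C (x) B) -> Hom(C, C (x) D) comes from that of [g] and of [mu] on [D]; it
    gives Ext^1 for [A], the one degree not reached by shifting. *)
Lemma auslander_left : auslander C B -> auslander C D -> auslander C A.
Proof.
move=> /auslanderP [tB eB mB] /auslanderP [tD eD mD]; apply/auslanderP.
have sx := tensor_short_exact fg (tD 0%N); case: (fg) => fI fgE gs.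
have ps : surjective (@postcomp R C _ _ (tmap C g)).
  move=> h; have [d ed] := bij_surj mD h; have [b eb] := gs d.
  by exists (mu C b); rewrite mu_natural eb ed.
split=> [j|j|]; first exact: tor_left fg _ _ _.
  case: j => [|j]; first exact: ext_left0 sx ps _.
  exact: ext_left sx PP _ _ _.
apply: inj_surj_bij.
  move=> x y e; apply: fI; apply: (bij_inj mB).
  by rewrite -!mu_natural e.
move=> h; have [b eb] := bij_surj mB (postcomp (tmap C f) h).
have /fgE [a ea] : g b = 0.
  apply: (bij_inj mD); rewrite -mu_natural eb postcomp0 //.
  by rewrite (zmod_morphism0 (@muB _)).
by exists a; apply: (postcomp_inj sx); rewrite mu_natural ea.
Qed.

(** Injectivity of C (x) f supplies Tor_1(C, D) = 0, hence a short exact sequence of tensor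
    products; Ext^1(C, C (x) A) = 0 then makes Hom(C, -) exact on it. *)
Lemma auslander_right : injective (tensor_map C f) ->
  auslander C A -> auslander C B -> auslander C D.
Proof.
move=> CfI /auslanderP [tA eA mA] /auslanderP [tB eB mB]; apply/auslanderP.
case: (fg) => fI fgE gs.
have t0 : tor_ex F 0 D by apply: (tor_right0 fg CfI).
have sx := tensor_short_exact fg t0.
have ps : surjective (@postcomp R C _ _ (tmap C g)) := ext_hom_surj sx PP (eA 0%N).
split=> [j|j|].
- by case: j => // j; apply: tor_right fg _ _ _.
- exact: ext_right sx PP _ _ _.
apply: inj_surj_bij.
  suff inj0 (d : D) : mu C d = 0 -> d = 0.
    by move=> x y e; apply/subr0_eq/inj0; rewrite muB e subrr.
  have [b <-] := gs d; rewrite -mu_natural => /(postcomp_exact sx) [k ek].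
  have [a ea] := bij_surj mA k; apply/fgE; exists a.
  by apply: (bij_inj mB); rewrite -mu_natural ea ek.
move=> h; have [k ek] := ps h; have [b eb] := bij_surj mB k.
by exists (g b); rewrite -mu_natural eb ek.
Qed.

End ShortExact.
End AuslanderClass.

(** * Projective modules lie in the Auslander class *)

Section AuslanderProjective.
Variables (R S : pzRingType) (C : bimodType R S).

Lemma ract0 (c : C) : ract c 0 = 0 :> C.
Proof. exact: (zmod_morphism0 (ract_zmodr c)). Qed.

Lemma pure0 (N : lmodType S) (c : C) : pure c (0 : N) = 0.
Proof. exact: (zmod_morphism0 (@pure_zmodr _ _ C N c)). Qed.

Section Contraction.
Variables (N : lmodType S) (phi : {linear N -> S^o}).

Lemma contract_balanced : balanced (fun (c : C) x => ract c (phi x : S)).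
Proof.
split=> [c c' x|c x x'|c a x]; first exact: ractDl.
- by rewrite linearD ractDr.
- by rewrite linearZ ractA.
Qed.

Lemma contract_linear :
  linear (tensor_lift (fun c x => ract c (phi x : S)) : tensor C N -> C).
Proof.
move=> a u v; rewrite (morphB_D (tensor_liftB contract_balanced)); congr (_ + _).
apply: (eq_tensor_morphism
  (f := fun u => tensor_lift (fun c x => ract c (phi x : S)) (a *: u))
  (g := fun u => a *: tensor_lift (fun c x => ract c (phi x : S)) u)) => [x y|x y|c x].
- by rewrite scalerBr tensor_liftB //; apply: contract_balanced.
- by rewrite tensor_liftB ?scalerBr //; apply: contract_balanced.
- by rewrite pureZ !tensor_liftE ?ractZ //; apply: contract_balanced.
Qed.

(** The map C (x) phi followed by C (x) S = C. *)
Definition contract : {linear tensor C N -> C} := mklin contract_linear.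

Lemma contractE c x : contract (pure c x) = ract c (phi x : S).
Proof. by apply: tensor_liftE; apply: contract_balanced. Qed.

End Contraction.

Lemma tensor_dual_basis (N : lmodType S) (us : seq (tensor C N)) : projective N ->
  exists b : seq ({linear N -> S^o} * N), forall u, u \in us ->
    u = \sum_(q <- b) pure (contract q.1 u) q.2.
Proof.
move=> NN; have /choice [s sE] := @tensor_sumE R S C N.
have [b bE] := projective_dual_basis (flatten [seq map snd (s u) | u <- us]) NN.
exists b => u uus.
transitivity (\sum_(p <- s u) \sum_(q <- b) pure (contract q.1 (pure p.1 p.2)) q.2).
  rewrite {1}[u]sE; apply: eq_big_seq => p pu.
  rewrite {1}[p.2]bE; last first.
    by apply/flattenP; exists (map snd (s u)); apply: map_f.
  rewrite (sum_zmod_morphism _ _ (@pure_zmodr _ _ C N p.1)); apply: eq_bigr => q _.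
  by rewrite contractE (balancedM (pure_balanced C N)).
rewrite exchange_big; apply: eq_bigr => q _.
rewrite [in RHS](sE u) linear_sum.
by rewrite (sum_zmod_morphism _ _ (@pure_zmodl _ _ C N q.2)).
Qed.

(** A map from a finitely generated module to C (x) N passes through a finite power of [C];
    questions about C (x) N are thus reduced to [C]. *)
Lemma fin_gen_tensor_dual (N : lmodType S) (M : lmodType R)
    (h : {linear M -> tensor C N}) : projective N -> fin_gen M ->
  exists b : seq ({linear N -> S^o} * N), forall x,
    h x = \sum_(q <- b) pure (contract q.1 (h x)) q.2.
Proof.
move=> NN [k [e eE]].
have [b bE] := tensor_dual_basis (codom (h \o e)) NN; exists b => x.
have [a ->] := eE x; rewrite linear_sum.
have lb : linear (fun u : tensor C N => \sum_(q <- b) pure (contract q.1 u) q.2).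
  move=> r u v; rewrite scaler_sumr -big_split; apply: eq_bigr => q _.
  by rewrite linearP pure_linear.
rewrite -[RHS]/(mklin lb _) linear_sum; apply: eq_bigr => i _.
rewrite !linearZ; congr (_ *: _); rewrite [LHS]bE //.
exact: (codom_f (h \o e)).
Qed.

Variables (F : free_resolution C) (sC : semidualizing C).

Lemma fin_gen_C : fin_gen C.
Proof.
have [Q QP] := semidual_a1 sC; have [_ [k [e eE]]] := QP 0%N.
exists k, (res_aug Q \o e) => c; have [x <-] := @res_surj _ _ Q c.
by have [a ->] := eE x; exists a; rewrite linear_sum; apply: eq_bigr => i _; rewrite linearZ.
Qed.

(** A cocycle is contracted to finitely many cocycles with values in [C], possible because the terms
    of [Q] are finitely generated; condition (c1) bounds each of them, and the bounding maps are
    reassembled. *)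
Lemma ext_tensor_projective (N : lmodType S) j : projective N ->
  Ext_zero j.+1 C (tensor C N).
Proof.
move=> NN; have [Q QP] := semidual_a1 sC.
have QQ : proj_resolution Q by move=> i; case: (QP i).
apply/(Ext_zeroP _ _ QQ) => h; split=> [/precomp0 h0|[g <-]]; last exact: precomp_dd.
have [b bE] := fin_gen_tensor_dual (h : {linear _ -> _}) NN (QP j.+1).2.
have /choice [w wE] (q : {linear N -> S^o} * N) : exists w : Hom (Q j) C,
    precomp (res_d Q j) w = postcomp (contract q.1) h.
  apply/((Ext_zeroP C j QQ).1 (semidual_c1 sC (isT : (1 <= j.+1)%N))).
  apply/precomp0 => x.
  rewrite -[LHS]/(contract q.1 ((h : {linear _ -> _}) (res_d Q j.+1 x))).
  by rewrite h0 linear0.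
have lg : linear (fun x => \sum_(q <- b) pure ((w q : {linear _ -> _}) x) q.2).
  move=> r u v; rewrite scaler_sumr -big_split; apply: eq_bigr => q _.
  by rewrite linearP pure_linear.
exists (mklin lg); apply: HomP => x; rewrite [RHS]bE; apply: eq_bigr => q _.
congr (pure _ _); rewrite -[LHS]/((precomp (res_d Q j) (w q) : {linear _ -> _}) x).
by rewrite wE.
Qed.

Lemma auslander_projective (N : lmodType S) : projective N -> auslander C N.
Proof.
move=> NN; split; [case=> // j _|case=> // j _|].
- by apply/(Tor_zeroP F); apply: tor_projective.
- exact: ext_tensor_projective.
have hS := semidual_b2 sC.
have muD := @muB R S C N.
apply: inj_surj_bij.
  suff inj0 (x : N) : mu C x = 0 -> x = 0.
    by move=> x y e; apply/subr0_eq/inj0; rewrite muB e subrr.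
  move=> x0; have [b bE] := projective_dual_basis [:: x] NN.
  rewrite [LHS]bE ?inE // big1 // => q _.
  suff -> : (q.1 x : S) = 0 by rewrite scale0r.
  apply: (bij_inj hS); apply: HomP => c /=.
  rewrite ract0 -contractE -[pure c x]/((mu C x : {linear _ -> _}) c) x0.
  exact: linear0.
(* The components of [h] are endomorphisms of [C], so by (b2) each is right multiplication by an
   element of [S]. *)
move=> h; have [b bE] := fin_gen_tensor_dual (h : {linear _ -> _}) NN fin_gen_C.
have /choice [s sE] (q : {linear N -> S^o} * N) : exists a : S,
  homothetyS C a = postcomp (contract q.1) h by apply: bij_surj hS _.
exists (\sum_(q <- b) s q *: q.2); apply: HomP => c; rewrite [RHS]bE.
rewrite -[LHS]/(pure c _) (sum_zmod_morphism _ _ (@pure_zmodr _ _ C N c)); apply: eq_bigr => q _.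
rewrite -(balancedM (pure_balanced C N)); congr (pure _ _).
by rewrite -[LHS]/((homothetyS C (s q) : {linear _ -> _}) c) sE.
Qed.

End AuslanderProjective.

Section FiniteFree.
Variables (T : pzRingType) (k : nat).

Definition unitvec (V : zmodType) (a : 'I_k) (x : V) : 'I_k -> V :=
  fun i => if i == a then x else 0.

Lemma unitvec_linear (V : lmodType T) a : linear (@unitvec V a).
Proof.
move=> r x y; apply/funext => i.
rewrite -[RHS]/(r *: unitvec a x i + unitvec a y i) /unitvec.
by case: eqP => // _; rewrite scaler0 addr0.
Qed.

Lemma sum_unitvec (V : zmodType) (z : 'I_k -> V) : z = \sum_a unitvec a (z a).
Proof.
apply/funext => i; rewrite fct_sumE (bigD1 i) //= /unitvec eqxx big1 ?addr0 //.
by move=> a; rewrite eq_sym => /negPf ->.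
Qed.

Lemma finite_free_basis (z : 'I_k -> T^o) : z = \sum_a (z a : T) *: unitvec a (1 : T^o).
Proof.
rewrite [LHS]sum_unitvec; apply: eq_bigr => a _; apply/funext => i.
rewrite -[RHS]/(z a * unitvec a 1 i) /unitvec.
by case: eqP => _; rewrite ?mulr1 ?mulr0.
Qed.

Lemma finite_free_lift (N : lmodType T) (y : 'I_k -> N) :
  exists h : {linear ('I_k -> T^o) -> N}, forall a, h (unitvec a 1) = y a.
Proof.
have lh : linear (fun z : 'I_k -> T^o => \sum_a (z a : T) *: y a).
  move=> r u v; rewrite scaler_sumr -big_split; apply: eq_bigr => a _.
  by rewrite -[LHS]/((r * u a + v a) *: y a) scalerDl scalerA.
exists (mklin lh) => a /=; rewrite (bigD1 a) //= /unitvec eqxx scale1r big1 ?addr0 //.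
by move=> i /negPf ->; rewrite scale0r.
Qed.

Lemma finite_free_projective : projective ('I_k -> T^o : lmodType T).
Proof.
move=> M N g f /choice [r rE].
have [h hE] := finite_free_lift (fun a => r (f (unitvec a 1))).
exists h => z; rewrite [z]finite_free_basis !linear_sum; apply: eq_bigr => a _.
by rewrite !linearZ hE rE.
Qed.

End FiniteFree.

(** * Modules of I_C(S) lie in the Auslander class *)

Section HomInjective.
Variables (R S : pzRingType) (C : bimodType R S) (F : free_resolution C).
Local Notation k := (frk F).
Local Notation D := (frmx (f := F)).
Local Notation Sc := (S^c)^o.

Fact frd_linear j : linear (fun (s : 'I_(k j.+1) -> Sc) =>
  (mxact (@D j) (N := S^o) s : 'I_(k j) -> Sc)).
Proof.
move=> r u v; apply/funext => a.
rewrite -[RHS]/((\sum_i D i a * (u i : S)) * r + \sum_i D i a * (v i : S)).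
rewrite mulr_suml -big_split; apply: eq_bigr => i _.
by rewrite -[LHS]/(D i a * ((u i : S) * r + (v i : S))) mulrDr mulrA.
Qed.

Fact fraug_linear : linear (fun s : 'I_(k 0) -> Sc =>
  (\sum_a ract (frgen a) (s a : S) : rmod C)).
Proof.
move=> r u v; rewrite scaler_sumr -big_split; apply: eq_bigr => a _.
by rewrite -[RHS]/(ract (ract (frgen a) (u a : S)) r + ract (frgen a) (v a : S)) ractA -ractDr.
Qed.

(** The matrices repackaged as a resolution over [S^c], so that (c2) can be applied to them. *)
Definition free_res : resolution (rmod C) :=
  @Resolution _ (rmod C) (fun j => 'I_(k j) -> Sc : lmodType S^c)
    (fun j => mklin (@frd_linear j)) (mklin fraug_linear)
    (fun j => @frexact _ _ _ F j) (@frrel _ _ _ F)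
    (fun c => let: ex_intro s e := frgenP F c in ex_intro _ s (esym e)).

Lemma free_res_proj : proj_resolution free_res.
Proof. by move=> j; apply: finite_free_projective. Qed.

(** The differential of the complex of right-linear maps from the free resolution to [C], with
    Hom(S^k, C) read as C^k. *)
Definition cd j (z : 'I_(k j) -> C) : 'I_(k j.+1) -> C :=
  fun i => \sum_a ract (z a) (D i a).

Fact cd_linear j : linear (@cd j).
Proof.
move=> r y z; apply/funext => i.
rewrite -[RHS]/(r *: cd y i + cd z i) scaler_sumr -big_split.
by apply: eq_bigr => a _; rewrite ractDl ractZ.
Qed.

Definition cd_map j : {linear ('I_(k j) -> C) -> ('I_(k j.+1) -> C)} :=
  mklin (@cd_linear j).

Lemma free_res_hom j (z : 'I_(k j) -> C) :
  exists h : Hom (free_res j) (rmod C),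
    forall s, (h : {linear _ -> _}) s = \sum_a ract (z a) (s a : S) :> C.
Proof.
have lh : linear (fun s : 'I_(k j) -> Sc => (\sum_a ract (z a) (s a : S) : rmod C)).
  move=> r u v; rewrite scaler_sumr -big_split; apply: eq_bigr => a _.
  by rewrite -[RHS]/(ract (ract (z a) (u a : S)) r + ract (z a) (v a : S)) ractA -ractDr.
by exists (mklin lh).
Qed.

Lemma ract0l a : ract (0 : C) a = 0 :> C.
Proof. exact: (zmod_morphism0 (@ract_zmodl _ _ C a)). Qed.

Lemma ract_suml (I : Type) (r : seq I) (f : I -> C) a :
  ract (\sum_(i <- r) f i) a = \sum_(i <- r) ract (f i) a :> C.
Proof. exact: (sum_zmod_morphism _ _ (@ract_zmodl _ _ C a)). Qed.

Lemma ract_sumr (I : Type) (r : seq I) (f : I -> S) (c : C) :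
  ract c (\sum_(i <- r) f i) = \sum_(i <- r) ract c (f i) :> C.
Proof. exact: (sum_zmod_morphism _ _ (ract_zmodr c)). Qed.

Lemma sum_cd j (z : 'I_(k j) -> C) (s : 'I_(k j.+1) -> S) :
  \sum_i ract (cd z i) (s i) = \sum_a ract (z a) (mxact (@D j) (N := S^o) s a).
Proof.
under eq_bigr => i _ do rewrite ract_suml.
rewrite exchange_big; apply: eq_bigr => a _; rewrite ract_sumr.
by apply: eq_bigr => i _; rewrite ractA.
Qed.

Lemma cd_cd j (z : 'I_(k j) -> C) : cd (cd z) = 0.
Proof.
apply/funext => i.
have := sum_cd (cd z) (fun l => (l == i)%:R); rewrite (bigD1 i) //= eqxx ract1.
rewrite big1 ?addr0 => [->|l /negPf ->]; last exact: ract0.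
rewrite sum_cd (_ : mxact _ _ = 0) ?big1 // => [a _|]; first exact: ract0.
exact: (exact_comp0 (fun l => (l == i)%:R : S^o) (@frexact _ _ _ F j)).
Qed.

Lemma eq_ract_sum m (y z : 'I_m -> C) :
  (forall s : 'I_m -> S, \sum_i ract (y i) (s i) = \sum_i ract (z i) (s i) :> C) -> y = z.
Proof.
move=> e; apply/funext => i.
have unit (w : 'I_m -> C) : \sum_l ract (w l) (l == i)%:R = w i :> C.
  by rewrite (bigD1 i) //= eqxx ract1 big1 ?addr0 // => l /negPf ->; apply: ract0.
by rewrite -[LHS]unit e unit.
Qed.

Lemma free_res_homE j (h : Hom (free_res j) (rmod C)) :
  exists z : 'I_(k j) -> C, forall s, (h : {linear _ -> _}) s = \sum_a ract (z a) (s a : S) :> C.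
Proof.
exists (fun a => (h : {linear _ -> _}) (unitvec a (1 : Sc))) => s.
rewrite [X in (_ : {linear _ -> _}) X](@finite_free_basis S^c (k j) s) linear_sum.
by apply: eq_bigr => a _; rewrite linearZ.
Qed.

Hypothesis sC : semidualizing C.

Lemma cd_exact j : exact_at (@cd j) (@cd j.+1).
Proof.
move=> z; split=> [z0|[y <-]]; last exact: cd_cd.
have [h hE] := free_res_hom z.
have ex := semidual_c2 sC (isT : (1 <= j.+1)%N) free_res_proj.
have /ex [g eg] : precomp (res_d free_res j.+1) h = 0.
  apply/precomp0 => s; rewrite hE -sum_cd z0 big1 // => i _.
  exact: ract0l.
have [y yE] := free_res_homE g; exists y; apply: eq_ract_sum => s.
by rewrite sum_cd -yE -hE -eg.
Qed.

(* Exactness of [0 -> R -> C^(k 0) -> C^(k 1)], which computes Hom(C_S, C_S) = R. *)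
Lemma cd_exact0 (z : 'I_(k 0) -> C) :
  cd z = 0 <-> exists r : R, (fun a => r *: (frgen a : C)) = z.
Proof.
split=> [z0|[r <-]]; last first.
  apply/funext => i; rewrite /cd; under eq_bigr => a _ do rewrite ractZ.
  by rewrite -scaler_sumr frgen_rel scaler0.
have [h hE] := free_res_hom z.
have /precomp_aug_exact [g eg] : precomp (res_d free_res 0) h = 0.
  apply/precomp0 => s; rewrite hE -sum_cd z0 big1 // => i _.
  exact: ract0l.
have [r er] := bij_surj (semidual_b1 sC) g.
exists r; apply: eq_ract_sum => s.
rewrite -hE -eg -er; under eq_bigr => a _ do rewrite ractZ.
by rewrite -scaler_sumr.
Qed.

Section Evaluation.
Variables (I : lmodType R) (II : injective_module I).
Local Notation H := (HomC C I : lmodType S).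

(** The identification of Hom_R(C, I)^k with Hom_R(C^k, I); under it [td] is the transpose of [cd]
    ([pairing_cd]). *)
Definition pairing j (u : 'I_(k j) -> HomC C I) (z : 'I_(k j) -> C) : I :=
  \sum_a (u a : {linear C -> I}) (z a).

Fact pairing_linear j (u : 'I_(k j) -> HomC C I) : linear (pairing u).
Proof.
move=> r y z; rewrite scaler_sumr -big_split; apply: eq_bigr => a _.
by rewrite -[(r *: y + z) a]/(r *: y a + z a) linearP.
Qed.

Lemma Hom_sumE (J : Type) (r : seq J) (f : J -> HomC C I) (c : C) :
  (\sum_(i <- r) f i : {linear C -> I}) c = \sum_(i <- r) (f i : {linear C -> I}) c.
Proof.
have eB : zmod_morphism (fun h : HomC C I => (h : {linear C -> I}) c) by [].
exact: (sum_zmod_morphism _ _ eB).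
Qed.

Lemma pairing_cd j (u : 'I_(k j.+1) -> H) (z : 'I_(k j) -> C) :
  pairing u (cd z) = pairing (td (F := F) u) z.
Proof.
rewrite /pairing /cd /td /mxact.
under eq_bigr => i _ do rewrite linear_sum.
rewrite exchange_big; apply: eq_bigr => a _; rewrite Hom_sumE.
by apply: eq_bigr.
Qed.

Lemma pairing_unitvec j (u : 'I_(k j) -> HomC C I) a c :
  pairing u (unitvec a c) = (u a : {linear C -> I}) c.
Proof.
rewrite /pairing (bigD1 a) //= /unitvec eqxx big1 ?addr0 // => i /negPf ->.
exact: linear0.
Qed.

Lemma pairing_inj j (u v : 'I_(k j) -> HomC C I) : pairing u =1 pairing v -> u = v.
Proof.
by move=> e; apply/funext => a; apply: HomP => c; rewrite -!pairing_unitvec.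
Qed.

Lemma pairing_ex j (V : {linear ('I_(k j) -> C) -> I}) :
  exists v : 'I_(k j) -> H, pairing v =1 V.
Proof.
have lv a : linear (fun c => V (unitvec a c)).
  by move=> r x y; rewrite unitvec_linear linearP.
exists (fun a => mklin (lv a)) => z.
by rewrite {2}[z]sum_unitvec linear_sum.
Qed.

Lemma td_lift j (u : 'I_(k j) -> H) : (forall z, cd z = 0 -> pairing u z = 0) ->
  exists v : 'I_(k j.+1) -> H, td v = u.
Proof.
move=> u0; have [V VE] := injective_extend (d := cd_map j) (h := mklin (pairing_linear u)) II u0.
have [v vE] := pairing_ex V; exists v; apply: pairing_inj => z.
by rewrite -pairing_cd vE; exact: VE.
Qed.

(** A cycle [u] kills the image of [cd], which by (c2) is the next kernel; injectivity of [I] then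
    writes [u] as a boundary. *)
Lemma tor_HomC j : tor_ex F j H.
Proof.
move=> u; split=> [u0|[v <-]]; last exact: td_td.
have [|v ev] := @td_lift _ u; last by exists v.
move=> _ /cd_exact [y <-]; rewrite pairing_cd.
by rewrite u0 /pairing big1.
Qed.

Lemma eval_balanced : balanced (fun (c : C) (h : H) => (h : {linear C -> I}) c).
Proof. by split=> // c c' h; rewrite linearD. Qed.

Fact eval_linear :
  linear (tensor_lift (fun c (h : H) => (h : {linear C -> I}) c) : tensor C H -> I).
Proof.
move=> a u v; rewrite (morphB_D (tensor_liftB eval_balanced)); congr (_ + _).
apply: (eq_tensor_morphism
  (f := fun u => tensor_lift (fun c (h : H) => (h : {linear C -> I}) c) (a *: u))
  (g := fun u => a *: tensor_lift (fun c (h : H) => (h : {linear C -> I}) c) u)) => [x y|x y|c x].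
- by rewrite scalerBr tensor_liftB //; apply: eval_balanced.
- by rewrite tensor_liftB ?scalerBr //; apply: eval_balanced.
- by rewrite pureZ !tensor_liftE ?linearZ //; apply: eval_balanced.
Qed.

Definition evalC : {linear tensor C H -> I} := mklin eval_linear.

Lemma evalCE c h : evalC (pure c h) = (h : {linear C -> I}) c.
Proof. by apply: tensor_liftE; apply: eval_balanced. Qed.

Lemma evalC_taug (u : 'I_(k 0) -> H) :
  evalC (taug u) = pairing u (fun a => frgen a).
Proof. by rewrite linear_sum; apply: eq_bigr => a _; rewrite evalCE. Qed.

(** The degree-zero counterpart of [tor_HomC]: by (b1) the kernel of the first [cd] is a copy of
    [R], and Hom_R(R, I) = I. *)
Lemma evalC_bij : bijective evalC.
Proof.
apply: inj_surj_bij.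
  apply: linear_inj => t; have [u <-] := taug_surj F t; rewrite evalC_taug => e0.
  have [|v <-] := @td_lift _ u; last exact: taug_td.
  move=> _ /cd_exact0 [r <-].
  rewrite -[LHS]/(mklin (pairing_linear u) (r *: (@frgen _ _ _ F : 'I_(k 0) -> C))).
  by rewrite linearZ /= e0 scaler0.
move=> y.
have lg : linear (fun r : R^o => (fun a => (r : R) *: (frgen a : C)) : 'I_(k 0) -> C).
  by move=> r s t; apply/funext => a; rewrite scalerDl -scalerA.
have lf : linear (fun r : R^o => (r : R) *: y).
  by move=> r s t; rewrite scalerDl -scalerA.
(* The map from [R] sending [1] to [y] is extended along the embedding of [R] in C^(k 0) by
   multiples of the generators; it is an embedding since [R] acts faithfully on [C]. *)
have [|V VE] := II (g := mklin lg) (mklin lf).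
  apply: linear_inj => r /= r0; apply: (bij_inj (semidual_b1 sC)).
  apply: HomP => c /=; have [s ->] := frgenP F c.
  rewrite !scaler_sumr; apply: eq_bigr => a _; rewrite -!ractZ.
  by rewrite -[LHS]/(ract ((fun a => (r : R) *: (frgen a : C)) a) (s a)) r0 scale0r.
have [v vE] := pairing_ex V; exists (taug v).
rewrite evalC_taug vE -[RHS]scale1r -[RHS]/(mklin lf 1) -VE.
by congr (V _); apply/funext => a; rewrite /= scale1r.
Qed.

Lemma auslander_HomC : auslander C H.
Proof.
have IH : injective_module (tensor C H).
  have [e [f fK eK]] : isomorphic (tensor C H) I by exists evalC; apply: evalC_bij.
  move=> M N g h gI; have [h' h'E] := II (e \o h) gI.
  have le : linear f by move=> a x y; apply: (can_inj fK); rewrite linearP !eK.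
  by exists (mklin le \o h' : {linear _ -> _}) => x; rewrite /= h'E /= fK.
split; [case=> // j _|case=> // j _|].
- by apply/(Tor_zeroP F); apply: tor_HomC.
- by move=> P PP; apply: ext_injective.
have muK : cancel (mu C (N := H)) (postcomp evalC).
  by move=> h; apply: HomP => c; apply: evalCE.
exists (postcomp evalC) => // h; apply: HomP => c.
apply: (bij_inj evalC_bij).
by rewrite -[LHS]/(evalC (pure c _)) evalCE.
Qed.

End Evaluation.
End HomInjective.

(** * Existence of free resolutions *)

Section FreeResolutionExistence.
Variable T : pzRingType.
Implicit Types K L M N P W Z : lmodType T.

Lemma fin_gen_prod M N : fin_gen M -> fin_gen N -> fin_gen ((M * N)%type : lmodType T).
Proof.
move=> [k [e eE]] [l [f fE]].
exists (k + l)%N, (fun i : 'I_(k + l) =>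
  match fintype.split i with inl a => (e a, 0) | inr b => (0, f b) end).
move=> [x y]; have [a ea] := eE x; have [b eb] := fE y.
exists (fun i : 'I_(k + l) => match fintype.split i with inl i => a i | inr j => b j end).
rewrite big_split_ord /=.
under eq_bigr => i _ do rewrite -[lshift l i]/(unsplit (inl i)) unsplitK.
under [X in _ + X]eq_bigr => i _ do rewrite -[rshift k i]/(unsplit (inr i)) unsplitK.
have lM : linear (fun x : M => (x, 0) : M * N).
  by move=> r u v; rewrite -[RHS]/(_, _) /= scaler0 addr0.
have lN : linear (fun x : N => (0, x) : M * N).
  by move=> r u v; rewrite -[RHS]/(_, _) /= scaler0 addr0.
under eq_bigr => i _ do rewrite -[(e i, 0)]/(mklin lM _) -linearZ.
under [X in _ + X]eq_bigr => i _ do rewrite -[(0, f i)]/(mklin lN _) -linearZ.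
by rewrite -!linear_sum -ea -eb -[RHS]/(_, _) /= addr0 add0r.
Qed.

Lemma fin_gen_free k : fin_gen ('I_k -> T^o : lmodType T).
Proof.
exists k, (fun a => unitvec a (1 : T^o)) => z; exists z; exact: finite_free_basis.
Qed.

Lemma fin_gen_cover M : fin_gen M ->
  exists k (q : {linear ('I_k -> T^o) -> M}), surjective q.
Proof.
move=> [k [e eE]]; have [q qE] := finite_free_lift e; exists k, q => x.
have [a ->] := eE x; exists a; rewrite [X in q X](finite_free_basis (a : 'I_k -> T^o)) linear_sum.
by apply: eq_bigr => i _; rewrite linearZ qE.
Qed.

Lemma fg_proj_cons K P M (f : {linear K -> P}) (g : {linear P -> M}) :
  short_exact f g -> projective P -> fin_gen P -> fg_proj_resolved K ->
  fg_proj_resolved M.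
Proof. by move=> fg PP fgP [W WP]; exists (res_cons fg W); case. Qed.

Lemma fg_proj_tail M : fg_proj_resolved M ->
  exists K (P : lmodType T) (f : {linear K -> P}) (g : {linear P -> M}),
  [/\ short_exact f g, projective P, fin_gen P & fg_proj_resolved K].
Proof.
move=> [W WP]; have [K [i [a [ip sa ea _]]]] := res_tail_ex W.
exists K, (W 0%N), i, (res_aug W); split=> //; try by case: (WP 0%N).
by exists (res_tail sa ea) => j; apply: WP.
Qed.

(** Replaces the first projective term by a finite free one while the new kernel stays resolved by
    finitely generated projectives, so that the step can be iterated. *)
Lemma fg_proj_free_tail M : fg_proj_resolved M ->
  exists K (P : lmodType T) (i : {linear K -> P}) (p : {linear P -> M}),
  [/\ short_exact i p, exists k, isomorphic ('I_k -> T^o : lmodType T) P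
    & fg_proj_resolved K].
Proof.
move=> /fg_proj_tail [Z0 [W0 [j0 [p0 [e0 P0 G0 R0]]]]].
have [Z1 [W1 [j1 [p1 [e1 P1 G1 R1]]]]] := fg_proj_tail R0.
have [Z2 [W2 [j2 [p2 [e2 P2 G2 R2]]]]] := fg_proj_tail R1.
have [k [q qs]] := fin_gen_cover G0.
have [s sK] := projective_section P0 qs.
have [j0I je0 p0s] := e0; have [j1I je1 p1s] := e1; have [j2I je2 p2s] := e2.
have [|K [i ip]] := @short_exact_ker _ _ _ (p0 \o q : {linear _ -> M}).
  by move=> x; have [w <-] := p0s x; have [z <-] := qs w; exists z.
exists K, ('I_k -> T^o : lmodType T), i, (p0 \o q); split=> //.
  by exists k; apply: isomorphic_refl.
have [iI ie _] := ip.
(* Since [s] splits [q], the kernel [K] is the sum of [s (j0 Z0)] and the kernel of [q]. The first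
   is covered by [W1], the second by [y - s (q y)], whose own kernel is the image of [s]; hence the
   kernel Z1 x W0 below. *)
have lF : linear (fun u : W1 * ('I_k -> T^o) => s (j0 (p1 u.1)) + (u.2 - s (q u.2))).
  move=> r u v; rewrite !linearP /= !scalerDr.
  by rewrite [RHS]addrACA; congr (_ + _); apply: addrACA.
have [|f fE] := lift_inj (f := mklin lF) iI.
  move=> [x y]; apply/ie; rewrite /= linearD linearB !sK subrr addr0.
  exact: (exact_comp0 _ je0).
have lG : linear (fun u : Z1 * W0 => (j1 u.1, s u.2) : W1 * ('I_k -> T^o)).
  by move=> r u v; rewrite !linearP.
have fGe : short_exact (mklin lG) f.
  split.
  - by apply: linear_inj => -[z w] /= [/(linear_inj0 j1I) -> /(linear_inj0 (can_inj sK)) ->].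
  - move=> [x y]; split=> [f0|[[z w] [<- <-]]].
      have e : s (j0 (p1 x)) + (y - s (q y)) = 0 by rewrite -[LHS](fE (x, y)) f0 linear0.
      have x0 : p1 x = 0.
        apply: (linear_inj0 j0I); have := congr1 q e.
        by rewrite linearD linearB !sK subrr addr0 linear0.
      have /je1 [z ez] := x0; exists (z, q y); congr (_, _); first exact: ez.
      by apply/esym/subr0_eq; rewrite -[RHS]e x0 !linear0 add0r.
    apply: iI; rewrite fE linear0 /= (exact_comp0 _ je1) !linear0 add0r.
    by rewrite sK subrr.
  - move=> y; have /je0 [z ez] : p0 (q (i y)) = 0 := exact_comp0 y ie.
    have [x ex] := p1s z; exists (x, i y); apply: iI.
    by rewrite fE /= ex ez addrC subrK.
apply: (fg_proj_cons fGe).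
- by apply: prod_projective => //; apply: finite_free_projective.
- by apply: fin_gen_prod => //; apply: fin_gen_free.
(* Z1 x W0 is covered by W2 x W0 with kernel [Z2], where the given resolution takes over. *)
have li : linear (fun z => (j2 z, 0) : W2 * W0).
  by move=> r u v; rewrite linearP -[RHS]/(_, _) /= scaler0 addr0.
have lp : linear (fun u : W2 * W0 => (p2 u.1, u.2) : Z1 * W0).
  by move=> r u v; rewrite linearP.
apply: (@fg_proj_cons _ _ _ (mklin li) (mklin lp)) R2; last exact: fin_gen_prod.
  split.
  - by apply: linear_inj => z /= [/(linear_inj0 j2I)].
  - move=> [x w]; split=> [[/je2 [z <-] ->]|[z [<- <-]]]; first by exists z.
    by congr (_, _); apply: (exact_comp0 _ je2).
  - by move=> [z w]; have [x <-] := p2s z; exists (x, w).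
exact: prod_projective.
Qed.

End FreeResolutionExistence.

Lemma free_resolution_ex (R S : pzRingType) (C : bimodType R S) :
  fg_proj_resolved (rmod C) -> exists F : free_resolution C, True.
Proof.
move=> /(resolution_ex (@fg_proj_free_tail S^c)) [W WX].
have F j : {k & {h : {linear ('I_k -> (S^c)^o) -> W j} & {g : W j -> ('I_k -> (S^c)^o) |
    cancel h g /\ cancel g h}}}.
  have /cid [k /cid [h hb]] := WX j; exists k, h.
  by apply: cid; case: hb => g; exists g.
pose k j := projT1 (F j).
pose h j : {linear ('I_(k j) -> (S^c)^o) -> W j} := projT1 (projT2 (F j)).
pose g j : W j -> ('I_(k j) -> (S^c)^o) := sval (projT2 (projT2 (F j))).
have hK j : cancel (h j) (g j) by case: (svalP (projT2 (projT2 (F j)))).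
have gK j : cancel (g j) (h j) by case: (svalP (projT2 (projT2 (F j)))).
pose D j (i : 'I_(k j.+1)) (a : 'I_(k j)) : S := g j (res_d W j (h j.+1 (unitvec i 1))) a.
have hD j (s : 'I_(k j.+1) -> S^o) : h j (mxact (@D j) s) = res_d W j (h j.+1 s).
  rewrite [X in h j.+1 X](@finite_free_basis S^c (k j.+1) s) !linear_sum.
  transitivity (h j (\sum_i (s i : S^c) *: g j (res_d W j (h j.+1 (unitvec i 1))))).
    by congr (h j _); apply/funext => a; rewrite fct_sumE; apply: eq_bigr.
  by rewrite linear_sum; apply: eq_bigr => i _; rewrite !linearZ gK.
pose e a : C := res_aug W (h 0%N (unitvec a 1)).
have he (s : 'I_(k 0) -> S^o) : res_aug W (h 0%N s) = \sum_a ract (e a) (s a : S).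
  rewrite [X in h 0%N X](@finite_free_basis S^c (k 0%N) s) !linear_sum.
  by apply: eq_bigr => i _; rewrite !linearZ.
have eP c : exists s : 'I_(k 0) -> S, c = \sum_a ract (e a) (s a).
  by have [w <-] := @res_surj _ _ W c; exists (g 0%N w); rewrite -he gK.
have h0 j (s : 'I_(k j) -> S^o) : s = 0 <-> h j s = 0.
  by split=> [->|/(linear_inj0 (can_inj (hK j)))] //; rewrite linear0.
have rel : exact_at (mxact (@D 0%N) (N := S^o))
    (fun s : 'I_(k 0) -> S^o => \sum_a ract (e a) (s a : S)).
  move=> s; rewrite -he (@res_exact0 _ _ W (h 0%N s)); split=> -[w ew].
    by exists (g 1%N w); apply: (can_inj (hK 0%N)); rewrite hD gK.
  by exists (h 1%N w); rewrite -hD ew.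
have ex j : exact_at (mxact (@D j.+1) (N := S^o)) (mxact (@D j) (N := S^o)).
  move=> s; rewrite h0 hD (@res_exact _ _ W j (h j.+1 s)); split=> -[w ew].
    by exists (g j.+2 w); apply: (can_inj (hK j.+1)); rewrite hD gK.
  by exists (h j.+2 w); rewrite -hD ew.
by exists (FreeResolution eP rel ex).
Qed.

(** * The equivalences *)

Section AuslanderDimension.
Variables (R S : pzRingType) (C : bimodType R S) (sC : semidualizing C).
Variables (F : free_resolution C) (Q : resolution C) (QQ : proj_resolution Q).
Implicit Types A B D H K L M N P W X Y Z : lmodType S.
Local Notation AC := (auslander C).
Local Notation IC := (C_injective C).

Lemma auslander_zero Z : zero_module Z -> AC Z.
Proof. by move=> Z0; apply: (auslander_projective F sC); apply: zero_projective. Qed.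

(** An isomorphism is an exact sequence with zero kernel, and the zero module is projective, so
    closure under cokernels applies. *)
Lemma auslander_iso M N : isomorphic M N -> AC M -> AC N.
Proof.
move=> [f fb] AM; have [Z Z0] := zero_module_ex S.
have sx : short_exact (\0 : {linear Z -> M}) f.
  split; [by move=> x y _; rewrite (Z0 x) (Z0 y)| |exact: bij_surj].
  move=> x; split=> [/(linear_inj0 (bij_inj fb)) ->|[z <-]]; last exact: linear0.
  by exists 0.
apply: (auslander_right F QQ sx) => //; last exact: auslander_zero.
apply: (@linear_inj _ _ _ (tmap C (\0 : {linear Z -> M}))) => u _.
have [s ->] := tensor_sumE u; rewrite big1 // => p _.
by rewrite (Z0 p.2) pure0.
Qed.

Lemma C_injective_iso M N : isomorphic M N -> IC M -> IC N.
Proof.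
move=> MN [I II MI]; exists I => //.
exact: isomorphic_trans (isomorphic_sym MN) MI.
Qed.

Lemma C_injective_zero Z : zero_module Z -> IC Z.
Proof.
move=> Z0; have [I I0] := zero_module_ex R; exists I.
  by move=> M N g f _; exists (\0 : {linear N -> I}) => x; rewrite [RHS]I0.
exists (\0 : {linear Z -> HomC C I}); apply: inj_surj_bij.
  by move=> x y _; rewrite (Z0 x) (Z0 y).
by move=> h; exists 0; apply: HomP => c; rewrite [RHS]I0 [LHS]I0.
Qed.

Lemma C_injective_auslander N : IC N -> AC N.
Proof.
by move=> [I II /isomorphic_sym NI]; apply: (auslander_iso NI); apply: (auslander_HomC F sC II).
Qed.

Lemma auslander_C_injective_embedding A : AC A ->
  exists Y D (f : {linear A -> Y}) (g : {linear Y -> D}),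
    [/\ short_exact f g, IC Y & AC D].
Proof.
move=> AA; have [E [j [EE jI]]] := enough_injectives (tensor C A).
have lJ : linear (fun a => postcomp j (mu C a) : HomC C E).
  move=> s x y; apply: HomP => c.
  rewrite -[LHS]/(j (pure c (s *: x + y))) -[RHS]/(j (pure (ract c s) x) + j (pure c y)).
  by rewrite (balancedDr (pure_balanced C A)) -(balancedM (pure_balanced C A)) linearD.
have JI : injective (mklin lJ).
  move=> x y e; apply: (bij_inj (auslander_mu AA)); apply: HomP => c; apply: jI.
  by rewrite -[LHS]/((mklin lJ x : {linear _ -> _}) c) e.
have [D [g Jg]] := short_exact_coker JI.
exists (HomC C E), D, (mklin lJ), g; split=> //.
  by exists E => //; apply: isomorphic_refl.
apply: (auslander_right F QQ Jg) => //; last exact: (auslander_HomC F sC EE).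
(* Evaluation after C (x) J gives back the embedding [j], so C (x) J is injective, as
   [auslander_right] requires. *)
have eJ u : evalC C E (tensor_map C (mklin lJ) u) = j u.
  apply: (eq_tensor_morphism (f := fun u => evalC C E (tensor_map C (mklin lJ) u)) (g := j)).
  - by move=> x y; rewrite tensor_mapB linearB.
  - by move=> x y; rewrite linearB.
  - by move=> c a; rewrite tensor_mapE evalCE.
by move=> u v e; apply: jI; rewrite -!eJ e.
Qed.

Lemma pdi_C_injective_auslander n M : pdi IC n M -> pdi AC n M.
Proof.
elim: n M => [|n IH] M /=; first exact: C_injective_auslander.
move=> [K [A [f [g [fg IA /IH dK]]]]].
by exists K, A, f, g; split=> //; apply: C_injective_auslander.
Qed.

(** Only the first term [A] over [B] changes: it is replaced by the preimage of [K], the kernel of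
    an epimorphism from [A] onto [X]; the remaining kernel [L] is the same. *)
Lemma pdi_auslander_ker n K B X (i : {linear K -> B}) (p : {linear B -> X}) :
  short_exact i p -> AC X -> pdi AC n B -> pdi AC n K.
Proof.
move=> ip AX; case: n => [|n] /=; first by move=> AB; apply: (auslander_left F QQ ip).
move=> [L [A [l [a [la AA dL]]]]].
have [K' [i' [p' [l' [a' [ip' la']]]]]] := short_exact_preimage la ip.
exists L, K', l', a'; split=> //; exact: (auslander_left F QQ ip').
Qed.

(** The extension splits, so A x P covers [W] with the same kernel [L] as [A] over [K]. *)
Lemma pdi_auslander_projective_ext n K W P (i : {linear K -> W}) (p : {linear W -> P}) :
  short_exact i p -> projective P -> pdi AC n K -> pdi AC n W.
Proof.
move=> ip PP; have AP := auslander_projective F sC PP; have [iI ie ps] := ip.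
case: n => [|n] /=; first by move=> AK; apply: (auslander_middle F QQ ip).
move=> [L [A [l [a [[lI la as_] AA dL]]]]].
have [s sK] := projective_section PP ps.
have lE : linear (fun u : A * P => i (a u.1) + s u.2).
  by move=> r u v; rewrite !linearP scalerDr addrACA.
have li : linear (fun x : L => (l x, 0) : A * P).
  by move=> r u v; rewrite linearP -[RHS]/(_, _) /= scaler0 addr0.
exists L, (A * P)%type, (mklin li), (mklin lE); split=> //.
  split.
  - by move=> x y /= [/lI].
  - move=> [x y]; split=> [/= e|[z [<- <-]]]; last first.
      by rewrite /= (exact_comp0 _ la) !linear0 addr0.
    have y0 : y = 0.
      by have := congr1 p e; rewrite linearD (exact_comp0 _ ie) add0r sK linear0.
    move: e; rewrite y0 linear0 addr0 => /(linear_inj0 iI) /la [z <-].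
    by exists z.
  - move=> w; have /ie [k ek] : p (w - s (p w)) = 0 by rewrite linearB sK subrr.
    by have [x ex] := as_ k; exists (x, p w); rewrite /= ex ek subrK.
have lx : linear (fun x : A => (x, 0) : A * P).
  by move=> r u v; rewrite -[RHS]/(_, _) /= scaler0 addr0.
have ly : linear (fun u : A * P => u.2) by [].
apply: (auslander_middle F QQ (f := mklin lx) (g := mklin ly)) => //; split.
- by move=> x y /= [].
- by move=> [x y]; split=> [/= ->|[z [_ <-]]] //; exists x.
- by move=> y; exists (0, y).
Qed.

(** The pullback [W] of A -> N and P -> N extends [P] by [K1], so its dimension is at most [n]; it
    also maps onto [A] with kernel the syzygy [L], which inherits the bound. *)
Lemma pdi_auslander_syz n N K : pdi AC n N -> syz n N K -> AC K.
Proof.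
elim: n N => [|n IH] N /=; first by move=> AN /isomorphic_sym NK; apply: auslander_iso NK AN.
move=> [K1 [A [f [g [fg AA dK1]]]]] [L [P [l [p [lp PP /IH]]]]]; apply.
have [W [i' [p' [j' [q' [ip' jq']]]]]] := short_exact_pullback fg lp.
apply: (pdi_auslander_ker jq' AA).
exact: (pdi_auslander_projective_ext ip' PP dK1).
Qed.

(** Passing to [K] lowers both the length and the Tor degrees by one. At the end Tor_1(C, N) = 0
    keeps C (x) f injective, and [N] is a cokernel inside the class. *)
Lemma pdi_auslander_tor m N : pdi AC m.+1 N -> (forall j, (m <= j)%N -> tor_ex F j N) ->
  pdi AC m N.
Proof.
elim: m N => [|m IH] N /=.
  move=> [K [A [f [g [fg AA AK]]]]] tN.
  by apply: (auslander_right F QQ fg) => //; apply: (tensor_map_inj fg); apply: tN.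
move=> [K [A [f [g [fg AA dK]]]]] tN; exists K, A, f, g; split=> //.
apply: IH => // j mj; apply: (tor_left fg); first exact: tN.
by have [] := (auslanderP F QQ A).1 AA.
Qed.

Lemma pdi_auslander_tor_le m n N : pdi AC m N ->
  (forall j, (n <= j)%N -> tor_ex F j N) -> pdi AC n N.
Proof.
move=> dN tN; have [mn|nm] := leqP m n.
  exact: (pdi_leq (@auslander_zero) mn dN).
elim: m dN nm => // m IH dN; rewrite ltnS leq_eqVlt => /predU1P [nm|nm].
  by rewrite nm; apply: pdi_auslander_tor => // j mj; apply: tN; rewrite nm.
apply: IH => //; apply: pdi_auslander_tor => // j mj.
by apply: tN; apply: leq_trans mj; apply: ltnW.
Qed.

(* [pd_le (C_injective C) H (n - 1)] *)
Definition pdi_pred n H := if n is n'.+1 then pdi IC n' H else zero_module H.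

Definition approx_left n N := exists H A (f : {linear H -> A}) (g : {linear A -> N}),
  [/\ short_exact f g, AC A & pdi_pred n H].

Definition approx_right n N := exists H A (f : {linear N -> H}) (g : {linear H -> A}),
  [/\ short_exact f g, AC A & pdi IC n H].

(** With [A] embedded in [Y], the new middle term is Y / H: resolving it by [Y] and then [H] costs
    one more step. For [n = 0], [H] vanishes and the quotient is [Y]. *)
Lemma approx_left_right n N : approx_left n N -> approx_right n N.
Proof.
move=> [H [A [f [g [fg AA dH]]]]].
have [Y [D [i [p [ip IY AD]]]]] := auslander_C_injective_embedding AA.
have [B [h' [a' [i' [p' [ha' ip']]]]]] := short_exact_quotient fg ip.
exists B, D, i', p'; split=> //; case: n dH => [|n] /= dH; last by exists H, Y, h', a'.
exact: C_injective_iso (short_exact_middle_iso ha' dH) IY.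
Qed.

(** The two approximations alternate: a right one for the kernel [K], pushed out along K -> A,
    becomes a left one for [N]. *)
Lemma pdi_auslander_approx n N : pdi AC n N -> approx_left n N.
Proof.
elim: n N => [|n IH] N.
  move=> AN; have [Z Z0] := zero_module_ex S.
  exists Z, N, (\0 : {linear Z -> N}), (idfun : {linear N -> N}); split=> //.
  exact: short_exact_id.
move=> [K [A [f [g [fg AA /IH /approx_left_right [H [D [i [p [ip AD dH]]]]]]]]]].
have [Z [i' [p' [j' [q' [ip' jq']]]]]] := short_exact_pushout fg ip.
by exists H, Z, i', p'; split=> //; apply: (auslander_middle F QQ jq').
Qed.

(** Extending a map N -> Hom_R(C, E) along [f] means, by adjunction, extending C (x) N -> E along C
    (x) f, which is injective because Tor_1(C, A) = 0. *)
Lemma approx_right_Hom_exact N H A (f : {linear N -> H}) (g : {linear H -> A}) :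
  short_exact f g -> AC A -> Hom_exact IC f g.
Proof.
move=> fg AA X [E EE [e [e' eK e'K]]]; have [fI fgE gs] := fg.
have [tA _ _] := (auslanderP F QQ A).1 AA.
split.
- move=> h k ehk; apply: HomP => a; have [b <-] := gs a.
  by rewrite -[LHS]/((precomp g h : {linear _ -> _}) b) ehk.
- move=> h; split=> [/precomp0 h0|[k <-]]; last first.
    by apply/precomp0 => x; rewrite /= (exact_comp0 _ fgE) linear0.
  have [|k kE] := factor_surj (f := h : {linear _ -> _}) gs.
    by move=> x /fgE [y <-]; apply: h0.
  by exists k; apply: HomP.
move=> h.
have CfI := tensor_map_inj fg (tA 0%N).
pose h1 : {linear N -> HomC C E} := e \o (h : {linear N -> X}).
have [k kE] := EE _ _ (tmap C f) (evalC C E \o tmap C h1) CfI.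
have lk : linear (fun x => postcomp k (mu C x) : HomC C E).
  move=> s x y; apply: HomP => c.
  rewrite -[LHS]/(k (pure c (s *: x + y))) -[RHS]/(k (pure (ract c s) x) + k (pure c y)).
  by rewrite (balancedDr (pure_balanced C H)) -(balancedM (pure_balanced C H)) linearD.
have le' : linear e' by move=> a x y; apply: (can_inj eK); rewrite linearP !e'K.
exists (mklin le' \o mklin lk : {linear H -> X}); apply: HomP => x.
rewrite -[LHS]/(e' (mklin lk (f x))); apply: (can_inj eK); rewrite e'K.
apply: HomP => c; rewrite -[LHS]/(k (pure c (f x))) -tensor_mapE [LHS]kE.
rewrite -[LHS]/(evalC C E (tensor_map C h1 (pure c x))) tensor_mapE.
by rewrite evalCE.
Qed.

End AuslanderDimension.

(** Syzygies are not unique, so (2) enters in two forms, for every [n]-th syzygy and for some; the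
    cycle passes from the first to the second. *)
Theorem theorem4p4 (R S : pzRingType) (C : bimodType R S) (N : lmodType S)
    (n : nat) :
  semidualizing C ->
  pd_finite (auslander C) N ->
  [<-> pd_le (auslander C) N n%:Z;
       forall K : lmodType S, syzygy n N K -> auslander C K;
       exists K : lmodType S, syzygy n N K /\ auslander C K;
       forall i : nat, (n + 1 <= i)%N -> Tor_zero i C N;
       exists (H A : lmodType S) (f : {linear H -> A}) (g : {linear A -> N}),
         [/\ short_exact f g, auslander C A
           & pd_le (C_injective C) H (n%:Z - 1)];
       exists (H' A' : lmodType S) (f : {linear N -> H'})
              (g : {linear H' -> A'}),
         [/\ short_exact f g, auslander C A'
           & pd_le (C_injective C) H' n%:Z];
       exists (H' A' : lmodType S) (f : {linear N -> H'})
              (g : {linear H' -> A'}),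
         [/\ short_exact f g, Hom_exact (C_injective C) f g, auslander C A'
           & pd_le (C_injective C) H' n%:Z]].
Proof.
move=> sC [m]; have [F _] := free_resolution_ex (semidual_a2 sC).
have [Q QQ] := projective_resolution_ex (C : lmodType R).
have pdA k M := pd_leP (auslander_iso sC F QQ) (auslander_zero sC F) k M.
have pdI k M := pd_leP (@C_injective_iso _ _ C) (@C_injective_zero _ _ C) k M.
(* At [k = 0] the integer [k%:Z - 1] is negative, and both sides say that the module is zero. *)
have pdP k M : pd_le (C_injective C) M (k%:Z - 1) <-> pdi_pred C k M.
  by case: k => [|k] //; have -> : k.+1%:Z - 1 = k by rewrite -addn1 PoszD addrK.
move=> /pdA dN; tfae.
- by move=> /pdA d K /syzygyP; apply: (pdi_auslander_syz sC F QQ d).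
- move=> h; have [K sK] := syz_ex n N; exists K; split; first exact/syzygyP.
  by apply: h; apply/syzygyP.
- move=> [K [/syzygyP sK AK]] [|i]; rewrite addn1 // ltnS => ni.
  apply/(Tor_zeroP F); apply: (tor_syz sK) => // j.
  by have [] := (auslanderP F QQ K).1 AK.
(* Here the finite dimension [m] enters: the vanishing of Tor can only lower a bound that already
   exists. *)
- move=> t; have d : pdi (auslander C) n N.
    apply: (pdi_auslander_tor_le (F := F) sC QQ dN) => j nj.
    by apply/Tor_zeroP/t; rewrite addn1 ltnS.
  have [H [A [f [g [fg AA dH]]]]] := pdi_auslander_approx sC F QQ d.
  by exists H, A, f, g; split=> //; apply/pdP.
- move=> [H [A [f [g [fg AA /pdP dH]]]]].
  have [|H' [A' [f' [g' [fg' AA' dH']]]]] := @approx_left_right _ _ _ sC F Q QQ n N.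
    by exists H, A, f, g.
  by exists H', A', f', g'; split=> //; apply/pdI.
- move=> [H [A [f [g [fg AA dH]]]]]; exists H, A, f, g; split=> //.
  exact: (approx_right_Hom_exact F QQ fg AA).
- move=> [H [A [f [g [fg _ AA /pdI dH]]]]]; apply/pdA.
  by apply: (pdi_auslander_ker F QQ fg AA); apply: (pdi_C_injective_auslander sC F QQ dH).
Qed.
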